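(* For any finite digraph $G$, any commutative ring $\mathbb{K}$ and any $n\geq 0$ there are isomorphisms of graded $\mathbb{K}$-modules $$\mathrm{MH}_{2n,*}(G)\cong\frac{R^n\cap JR^{n-1}J}{JR^n+R^nJ},\qquad \mathrm{MH}_{2n+1,*}(G)\cong\frac{JR^n\cap R^nJ}{R^{n+1}+JR^nJ}.$$ Moreover, for any vertices $x,y$ of $G$ there are isomorphisms $$\mathrm{MH}_{2n,*}(G)_{x,y}\cong\frac{e_x(R^n\cap JR^{n-1}J)e_y}{e_x(JR^n+R^nJ)e_y},\qquad \mathrm{MH}_{2n+1,*}(G)_{x,y}\cong\frac{e_x(JR^n\cap R^nJ)e_y}{e_x(R^{n+1}+JR^nJ)e_y}$$ that are compatible with the previous two isomorphisms. Here $R^0=\mathbb{K}G$, and for $n=0$ the numerator $R^n\cap JR^{n-1}J$ is understood to be $\mathbb{K}G$.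
   Context: A digraph $G$ consists of a set of vertices and a set of arrows, which are ordered pairs of distinct vertices. A path of length $n\ge 0$ in $G$ is a tuple of vertices $(p_0,\dots,p_n)$ such that each $(p_i,p_{i+1})$ is an arrow; $d(x,y)$ is the infimum of lengths of paths from $x$ to $y$ ($\infty$ if there are none). A path $(p_0,\dots,p_n)$ is shortest if $d(p_0,p_n)=n$, and long otherwise. Two paths connect the same vertices if they have the same initial vertex and the same terminal vertex. Magnitude homology: put $|x_0,\dots,x_n|=\sum_{i=0}^{n-1}d(x_i,x_{i+1})$. For $\ell\ge0$, $\mathrm{MC}_{n,\ell}(G)$ is the free $\mathbb{K}$-module on tuples $(x_0,\dots,x_n)$ of vertices with $x_i\neq x_{i+1}$ for all $i$ and $|x_0,\dots,x_n|=\ell$. The differential is $\partial_n=\sum_{i=0}^n(-1)^i\partial_{n,i}$, where $\partial_{n,i}(x_0,\dots,x_n)=(x_0,\dots,\hat x_i,\dots,x_n)$ if $|x_0,\dots,\hat x_i,\dots,x_n|=\ell$ and $0$ otherwise. Then $\mathrm{MH}_{n,\ell}(G)=H_n(\mathrm{MC}_{\bullet,\ell}(G))$, and $\mathrm{MH}_{n,*}(G)$ is the graded module with components $\mathrm{MH}_{n,\ell}(G)$. For vertices $x,y$, $\mathrm{MC}_{\bullet,\ell}(G)_{x,y}$ is the subcomplex spanned by tuples with $x_0=x$, $x_n=y$; $\mathrm{MH}_{n,\ell}(G)_{x,y}$ is its homology, and $\mathrm{MH}_{n,\ell}(G)=\bigoplus_{x,y}\mathrm{MH}_{n,\ell}(G)_{x,y}$.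 The path algebra $\mathbb{K}G$ is the free $\mathbb{K}$-module on all paths (including the length-zero paths $e_x=(x)$), with product given by concatenation when defined and zero otherwise, graded by path length. $J$ is the ideal generated by all paths of length $\geq1$. $R$ is the two-sided ideal generated by all differences $p-q$ of shortest paths connecting the same vertices, and by all long paths. For ideals $\mathfrak{b}\subseteq\mathfrak{a}$ of $\mathbb{K}G$ there is a decomposition $\mathfrak{a}/\mathfrak{b}\cong\bigoplus_{x,y}e_x\mathfrak{a}e_y/e_x\mathfrak{b}e_y$. Given an isomorphism $\varphi:V\to U$ and decompositions $V\cong\bigoplus_a V_a$, $U\cong\bigoplus_aU_a$, isomorphisms $\varphi_a:V_a\to U_a$ are compatible with $\varphi$ if $\varphi$ corresponds to $\bigoplus_a\varphi_a$ under the decompositions. *)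

(* Defs.v *)
From HB Require Import structures.
From mathcomp Require Import all_boot all_order all_algebra generic_quotient.
From mathcomp Require Import ring_quotient finmap all_classical.

Set Implicit Arguments.
Unset Strict Implicit.
Unset Printing Implicit Defensive.

Import GRing.Theory.
Import Quotient.

Local Open Scope classical_set_scope.
Local Open Scope ring_scope.
Local Open Scope quotient_scope.

Section DirectSum.
Context {K : pzRingType} {I : choiceType}.
Implicit Type M : I -> lmodType K.

Record dsum M := DSum {
  dsum_val :> forall i, M i;
  _ : finite_set [set i | dsum_val i <> 0]
}.

HB.instance Definition _ M := gen_eqMixin (dsum M).
HB.instance Definition _ M := gen_choiceMixin (dsum M).

Lemma dsum_finite M (u : dsum M) : finite_set [set i | u i <> 0].
Proof. by case: u. Qed.

Lemma dsumP M (u v : dsum M) : (forall i, u i = v i) -> u = v.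
Proof.
case: u v => [u hu] [v hv] /= uv; have e : u = v by apply: functional_extensionality_dep.
by case: _ / e hv => hv; congr DSum; exact: Prop_irrelevance.
Qed.

Section Ops.
Variable M : I -> lmodType K.
Implicit Types u v w : dsum M.

Fact dsum0_subproof : finite_set [set i | (0 : M i) <> 0].
Proof. by apply: (sub_finite_set _ (finite_set0 I)) => i /=. Qed.
Definition dsum0 : dsum M := DSum dsum0_subproof.

Fact dsumN_subproof u : finite_set [set i | - u i <> 0].
Proof.
by apply: sub_finite_set (dsum_finite u) => i /= h ui; apply: h; rewrite ui oppr0.
Qed.
Definition dsumN u : dsum M := DSum (dsumN_subproof u).

Fact dsumD_subproof u v : finite_set [set i | u i + v i <> 0].
Proof.
have fin : finite_set ([set i | u i <> 0] `|` [set i | v i <> 0]).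
  by rewrite finite_setU; split; exact: dsum_finite.
apply: sub_finite_set fin => i /= h; case: (pselect (u i = 0)) => [ui|]; last by left.
by right => vi; apply: h; rewrite ui vi addr0.
Qed.
Definition dsumD u v : dsum M := DSum (dsumD_subproof u v).

Fact dsumZ_subproof a u : finite_set [set i | a *: u i <> 0].
Proof.
by apply: sub_finite_set (dsum_finite u) => i /= h ui; apply: h; rewrite ui scaler0.
Qed.
Definition dsumZ a u : dsum M := DSum (dsumZ_subproof a u).

Fact dsum_addA : associative dsumD.
Proof. by move=> u v w; apply: dsumP => i /=; rewrite addrA. Qed.
Fact dsum_addC : commutative dsumD.
Proof. by move=> u v; apply: dsumP => i /=; rewrite addrC. Qed.
Fact dsum_add0 : left_id dsum0 dsumD.
Proof. by move=> u; apply: dsumP => i /=; rewrite add0r. Qed.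
Fact dsum_addN : left_inverse dsum0 dsumN dsumD.
Proof. by move=> u; apply: dsumP => i /=; rewrite addNr. Qed.

HB.instance Definition _ :=
  GRing.isZmodule.Build (dsum M) dsum_addA dsum_addC dsum_add0 dsum_addN.

Fact dsum_scaleA a b u : dsumZ a (dsumZ b u) = dsumZ (a * b) u.
Proof. by apply: dsumP => i /=; rewrite scalerA. Qed.
Fact dsum_scale1 : left_id 1 dsumZ.
Proof. by move=> u; apply: dsumP => i /=; rewrite scale1r. Qed.
Fact dsum_scaleDr : right_distributive dsumZ +%R.
Proof. by move=> a u v; apply: dsumP => i /=; rewrite scalerDr. Qed.
Fact dsum_scaleDl u : {morph dsumZ^~ u : a b / a + b}.
Proof. by move=> a b; apply: dsumP => i /=; rewrite scalerDl. Qed.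

HB.instance Definition _ := GRing.Zmodule_isLmodule.Build K (dsum M)
  dsum_scaleA dsum_scale1 dsum_scaleDr dsum_scaleDl.

Lemma dsum0E i : (0 : dsum M) i = 0. Proof. by []. Qed.
Lemma dsumDE u v i : (u + v) i = u i + v i. Proof. by []. Qed.
Lemma dsumZE a u i : (a *: u) i = a *: u i. Proof. by []. Qed.

End Ops.

Section Map.
Variables (M N : I -> lmodType K) (f : forall i, {linear M i -> N i}).

Fact dsum_map_subproof (u : dsum M) : finite_set [set i | f i (u i) <> 0].
Proof.
apply: sub_finite_set (dsum_finite u) => i /= h ui.
by apply: h; rewrite ui linear0.
Qed.
Definition dsum_map (u : dsum M) : dsum N := DSum (dsum_map_subproof u).

Fact dsum_map_linear : linear dsum_map.
Proof. by move=> a u v; apply: dsumP => i /=; rewrite linearP. Qed.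
HB.instance Definition _ :=
  GRing.isLinear.Build K (dsum M) (dsum N) _ dsum_map dsum_map_linear.
End Map.

End DirectSum.

Definition freemod (K : pzRingType) (T : choiceType) := dsum (fun _ : T => K^o).

Section FreeModule.
Context {K : pzRingType} {T : choiceType}.

HB.instance Definition _ := GRing.Lmodule.on (freemod K T).

Fact basis_subproof (t : T) : finite_set [set s | ((s == t)%:R : K^o) <> 0].
Proof.
apply: (sub_finite_set _ (finite_set1 t)) => s /=.
by case: eqP => // _; rewrite mulr0n.
Qed.
Definition basis (t : T) : freemod K T := DSum (basis_subproof t).

Definition flift (V : lmodType K) (phi : T -> V) (u : freemod K T) : V :=
  \sum_(t \in [set: T]) (u t : K) *: phi t.

Lemma fliftE (V : lmodType K) (phi : T -> V) (A : {fset T}) (u : freemod K T) :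
  (forall t, t \notin A -> u t = 0) ->
  flift phi u = \sum_(t <- A) (u t : K) *: phi t.
Proof. by move=> uA; apply: fsbigTE => t /uA ->; rewrite scale0r. Qed.

Lemma freemod_supp (u : freemod K T) :
  exists A : {fset T}, forall t, t \notin A -> u t = 0.
Proof.
exists (fset_set [set t | u t <> 0]) => t; rewrite in_fset_set; last exact: dsum_finite.
by apply: contraNeq => /eqP ut; rewrite inE.
Qed.

Fact flift_linear (V : lmodType K) (phi : T -> V) : linear (flift phi).
Proof.
move=> a u v; have [A uA] := freemod_supp u; have [B vB] := freemod_supp v.
have uAB t : t \notin (A `|` B)%fset -> u t = 0.
  by rewrite inE negb_or => /andP[/uA].
have vAB t : t \notin (A `|` B)%fset -> v t = 0.
  by rewrite inE negb_or => /andP[_ /vB].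
rewrite (fliftE _ uAB) (fliftE _ vAB) (@fliftE _ _ (A `|` B)%fset); last first.
  by move=> t tAB; rewrite dsumDE dsumZE uAB // vAB // scaler0 addr0.
rewrite scaler_sumr -big_split; apply: eq_bigr => t _ /=.
by rewrite scalerDl scalerA.
Qed.
HB.instance Definition _ (V : lmodType K) (phi : T -> V) :=
  GRing.isLinear.Build K (freemod K T) V _ (flift phi) (flift_linear phi).

Lemma flift_basis (V : lmodType K) (phi : T -> V) t : flift phi (basis t) = phi t.
Proof.
rewrite (@fliftE _ _ [fset t]%fset) ?big_seq_fset1 /= ?eqxx ?scale1r // => s.
by rewrite inE => /negbTE ->.
Qed.

Lemma flift_id (u : freemod K T) : flift basis u = u.
Proof.
have [A uA] := freemod_supp u; apply: dsumP => s; rewrite (fliftE _ uA).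
have -> : forall r, (\sum_(t <- r) (u t : K) *: basis t : freemod K T) s =
    \sum_(t <- r) (u t : K) * (s == t)%:R :> K.
  by elim=> [|t r IH]; rewrite ?big_nil // !big_cons dsumDE dsumZE IH.
have [sA|sA] := boolP (s \in A).
  rewrite (big_fsetD1 s sA) /= eqxx mulr1 big1_fset ?addr0 // => t.
  by rewrite !inE eq_sym => /andP[/negbTE ->]; rewrite mulr0.
rewrite uA // big1_fset // => t tA _.
by case: eqP tA sA => [<- ->//|]; rewrite mulr0.
Qed.

Lemma freemod_lin_ext (V : lmodType K) (f g : freemod K T -> V) :
  linear f -> linear g -> (forall t, f (basis t) = g (basis t)) -> f =1 g.
Proof.
move=> lf lg fg u; have [A uA] := freemod_supp u.
pose f' : {linear freemod K T -> V} := HB.pack f (GRing.isLinear.Build _ _ _ _ f lf).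
pose g' : {linear freemod K T -> V} := HB.pack g (GRing.isLinear.Build _ _ _ _ g lg).
rewrite -[f]/(f' : _ -> _) -[g]/(g' : _ -> _).
rewrite -(flift_id u) (fliftE _ uA) !linear_sum; apply: eq_bigr => t _.
by rewrite !linearZ /= fg.
Qed.

End FreeModule.

Section Submodules.
Context {K : pzRingType} {V : lmodType K}.

Definition span (S : set V) : {pred V} := fun v =>
  `[< exists (n : nat) (c : 'I_n -> K) (s : 'I_n -> V),
        (forall i, S (s i)) /\ v = \sum_i c i *: s i >].

Lemma mem_span (S : set V) v : S v -> v \in span S.
Proof.
by move=> Sv; apply/asboolP; exists 1, (fun=> 1), (fun=> v); rewrite big_ord1 scale1r.
Qed.

Fact span_closed (S : set V) : subsemimod_closed (span S).
Proof.
split; [split|].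
- by apply/asboolP; exists 0, (fun=> 0), (fun=> 0); rewrite big_ord0; split=> // -[].
- move=> _ _ /asboolP[m [c [s [Ss ->]]]] /asboolP[n [d [t [St ->]]]].
  apply/asboolP; exists (m + n)%N.
  exists (fun i => match fintype.split i with inl j => c j | inr j => d j end).
  exists (fun i => match fintype.split i with inl j => s j | inr j => t j end); split.
    by move=> i; case: fintype.split.
  rewrite big_split_ord; congr (_ + _); apply: eq_bigr => i _.
    by rewrite (unsplitK (inl i)).
  by rewrite (unsplitK (inr i)).
- move=> a _ /asboolP[n [c [s [Ss ->]]]]; apply/asboolP.
  exists n, (fun i => a * c i), s; split => //.
  by rewrite scaler_sumr; apply: eq_bigr => i _; rewrite scalerA.
Qed.
HB.instance Definition _ S := GRing.isSubmodClosed.Build K V (span S) (span_closed S).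

Definition fullm : {pred V} := predT.
Fact fullm_closed : subsemimod_closed fullm. Proof. by []. Qed.
HB.instance Definition _ := GRing.isSubmodClosed.Build K V fullm fullm_closed.

Definition capm (A B : {pred V}) : {pred V} := [predI A & B].
Fact capm_closed (A B : submodClosed V) : subsemimod_closed (capm A B).
Proof.
split; [split|]; rewrite ?inE ?rpred0 //.
- by move=> u v /andP[uA uB] /andP[vA vB]; rewrite !inE !rpredD.
- by move=> a u /andP[uA uB]; rewrite !inE !rpredZ.
Qed.
HB.instance Definition _ (A B : submodClosed V) :=
  GRing.isSubmodClosed.Build K V (capm A B) (capm_closed A B).

Definition addm (A B : {pred V}) : {pred V} := fun v =>
  `[< exists a b, [/\ a \in A, b \in B & v = a + b] >].
Fact addm_closed (A B : submodClosed V) : subsemimod_closed (addm A B).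
Proof.
split; [split|].
- by apply/asboolP; exists 0, 0; rewrite !rpred0 addr0.
- move=> _ _ /asboolP[a [b [aA bB ->]]] /asboolP[c [d [cA dB ->]]].
  by apply/asboolP; exists (a + c), (b + d); rewrite !rpredD // addrACA.
- move=> k _ /asboolP[a [b [aA bB ->]]]; apply/asboolP.
  by exists (k *: a), (k *: b); rewrite !rpredZ // scalerDr.
Qed.
HB.instance Definition _ (A B : submodClosed V) :=
  GRing.isSubmodClosed.Build K V (addm A B) (addm_closed A B).

End Submodules.

Section LinearImage.
Context {K : pzRingType} {V W : lmodType K}.

Definition imagem (f : V -> W) (A : {pred V}) : {pred W} :=
  fun w => `[< exists2 v, v \in A & w = f v >].
Fact imagem_closed (f : {linear V -> W}) (A : submodClosed V) :
  subsemimod_closed (imagem f A).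
Proof.
split; [split|].
- by apply/asboolP; exists 0; rewrite ?rpred0 // linear0.
- move=> _ _ /asboolP[u uA ->] /asboolP[v vA ->]; apply/asboolP.
  by exists (u + v); rewrite ?rpredD // linearD.
- move=> a _ /asboolP[u uA ->]; apply/asboolP.
  by exists (a *: u); rewrite ?rpredZ // linearZ.
Qed.
HB.instance Definition _ (f : {linear V -> W}) (A : submodClosed V) :=
  GRing.isSubmodClosed.Build K W (imagem f A) (imagem_closed f A).

Definition kerm (f : V -> W) : {pred V} := [pred v | f v == 0].
Fact kerm_closed (f : {linear V -> W}) : subsemimod_closed (kerm f).
Proof.
split; [split|]; rewrite ?inE ?linear0 //.
- by move=> u v /eqP fu /eqP fv; rewrite !inE linearD fu fv addr0.
- by move=> a u /eqP fu; rewrite !inE linearZ /= fu scaler0.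
Qed.
HB.instance Definition _ (f : {linear V -> W}) :=
  GRing.isSubmodClosed.Build K V (kerm f) (kerm_closed f).
End LinearImage.

Section QuotientModule.
Context {K : pzRingType} {V : lmodType K}.

(* over a ring, [submodClosed] does not inherit from [zmodClosed] in the library *)
Definition zmod_of (B : {pred V}) : {pred V} := B.
Fact zmod_of_closed (B : submodClosed V) : zmod_closed (zmod_of B).
Proof.
split=> [|u v uB vB]; first exact: rpred0 B.
by rewrite /zmod_of rpredD // -scaleN1r rpredZ.
Qed.
HB.instance Definition _ (B : submodClosed V) :=
  GRing.isZmodClosed.Build V (zmod_of B) (zmod_of_closed B).

Variable B : submodClosed V.

Definition quotmod := {quot (zmod_of B)}.
HB.instance Definition _ := GRing.Zmodule.on quotmod.
HB.instance Definition _ := EqQuotient.on quotmod.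

Definition quot_scale (a : K) := lift_op1 quotmod ( *:%R a).

Fact pi_scale a : {morph \pi_quotmod : u / a *: u >-> quot_scale a u}.
Proof.
move=> u; unlock quot_scale; apply/eqP; rewrite piE equivE -scalerBr.
by apply: (rpredZ (s := B)); rewrite -[_ \in _]/(_ \in zmod_of B) idealrBE reprK.
Qed.
Canonical pi_scale_morph a := PiMorph1 (pi_scale a).

Fact quot_scaleA a b q : quot_scale a (quot_scale b q) = quot_scale (a * b) q.
Proof. by rewrite -[q]reprK !piE scalerA. Qed.
Fact quot_scale1 : left_id 1 quot_scale.
Proof. by move=> q; rewrite -[q]reprK !piE scale1r. Qed.
Fact quot_scaleDr : right_distributive quot_scale +%R.
Proof. by move=> a p q; rewrite -[p]reprK -[q]reprK !piE scalerDr. Qed.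
Fact quot_scaleDl q : {morph quot_scale^~ q : a b / a + b}.
Proof. by move=> a b; rewrite -[q]reprK !piE scalerDl. Qed.
HB.instance Definition _ := GRing.Zmodule_isLmodule.Build K quotmod
  quot_scaleA quot_scale1 quot_scaleDr quot_scaleDl.

Fact pi_quotmod_linear : linear (\pi_quotmod : V -> quotmod).
Proof. by move=> a u v; rewrite pi_addr pi_scale. Qed.

End QuotientModule.

Section Subquotient.
Context {K : pzRingType} {V : lmodType K}.

Definition submod (A : submodClosed V) := {v : V | v \in A}.
HB.instance Definition _ A := SubChoice.on (submod A).
HB.instance Definition _ A := [SubChoice_isSubLmodule of submod A by <:].

Definition within (A : submodClosed V) (B : {pred V}) : {pred submod A} :=
  [pred u | val u \in B].
Arguments within A B : clear implicits.
Fact within_closed (A B : submodClosed V) : subsemimod_closed (within A B).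
Proof.
split; [split|]; rewrite ?inE ?rpred0 //.
- by move=> u v; rewrite !inE /= => uB vB; rewrite rpredD.
- by move=> a u; rewrite !inE /= => uB; rewrite rpredZ.
Qed.
HB.instance Definition _ (A B : submodClosed V) :=
  GRing.isSubmodClosed.Build K (submod A) (within A B) (within_closed A B).

(* This is A / B when B is contained in A, and A / (A :&: B) in general. *)
Definition subquot (A B : submodClosed V) := quotmod (within A B).
HB.instance Definition _ A B := GRing.Lmodule.on (subquot A B).
HB.instance Definition _ A B := EqQuotient.on (subquot A B).

(* meaningful for v in A; the junk value is 0 *)
Definition cls (A B : submodClosed V) (v : V) : subquot A B :=
  \pi_(subquot A B) (insubd (0 : submod A) v).

Lemma cls_eq (A B : submodClosed V) u v : u \in A -> v \in A ->
  (cls A B u == cls A B v) = (u - v \in B).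
Proof.
by move=> uA vA; rewrite piE equivE /zmod_of inE /= !insubdK.
Qed.

Lemma cls_surj (A B : submodClosed V) (q : subquot A B) :
  exists2 v, v \in A & q = cls A B v.
Proof.
exists (val (repr q)); first exact: valP.
by rewrite /cls valKd reprK.
Qed.

Lemma cls_lin (A B : submodClosed V) a u v : u \in A -> v \in A ->
  cls A B (a *: u + v) = a *: cls A B u + cls A B v.
Proof.
move=> uA vA; rewrite -[RHS]pi_quotmod_linear; congr (\pi_(subquot A B) _).
by apply: val_inj; rewrite insubdK /= ?insubdK // [_ \in _]rpredD ?rpredZ.
Qed.

Section Inclusion.
Variables (A B A' B' : submodClosed V).

Definition subquot_incl of {subset A <= A'} & {subset B <= B'} :=
  fun q : subquot A B => cls A' B' (val (repr q)).

Variables (sAA' : {subset A <= A'}) (sBB' : {subset B <= B'}).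

Lemma subquot_incl_cls v : v \in A -> subquot_incl sAA' sBB' (cls A B v) = cls A' B' v.
Proof.
move=> vA; apply/eqP; rewrite cls_eq ?sAA' //; last exact: valP.
apply: sBB'; have := cls_eq B (valP (repr (cls A B v))) vA.
by rewrite {1}/cls valKd reprK eqxx => <-.
Qed.

Fact subquot_incl_linear : linear (subquot_incl sAA' sBB').
Proof.
move=> a p q; have [u uA ->] := cls_surj p; have [v vA ->] := cls_surj q.
rewrite -cls_lin // !subquot_incl_cls ?cls_lin ?sAA' //.
by rewrite rpredD ?rpredZ.
Qed.
HB.instance Definition _ := GRing.isLinear.Build K (subquot A B) (subquot A' B') _
  (subquot_incl sAA' sBB') subquot_incl_linear.
End Inclusion.

End Subquotient.

Arguments subquot_incl {K V A B A' B'}.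

Section Graded.
Context {K : pzRingType}.

(* A module with its homogeneous components. That the module is the direct sum of
   the components is not part of the structure: it holds for [dsum_graded] and is
   transported by [graded_iso]. *)
Record gradedModule := GradedModule {
  gr_module :> lmodType K;
  gr_comp : nat -> set gr_module
}.
Arguments gr_comp : clear implicits.

Definition dsum_graded (M : nat -> lmodType K) : gradedModule :=
  @GradedModule (dsum M) (fun l => [set u | forall k, k <> l -> u k = 0]).

Definition graded_iso (M N : gradedModule) (f : {linear M -> N}) :=
  bijective f /\ forall l, f @` gr_comp M l = gr_comp N l.

(* The decompositions of [M] and [N] are given by the embeddings [inM i], [inN i] of
   the summands. *)
Definition compatible (I : finType) (M N : lmodType K) (M_ N_ : I -> lmodType K)
    (inM : forall i, M_ i -> M) (inN : forall i, N_ i -> N)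
    (f : M -> N) (f_ : forall i, M_ i -> N_ i) :=
  forall u : (forall i, M_ i), f (\sum_i inM i (u i)) = \sum_i inN i (f_ i (u i)).

End Graded.

Arguments gradedModule : clear implicits.
Arguments gr_comp {K}.

Record digraph := Digraph {
  vertex :> finType;
  arrow : rel vertex;
  arrow_irr : irreflexive arrow
}.

Section Paths.
Variable G : digraph.

(* the path (p_0, ..., p_n) is encoded as (p_0, [:: p_1; ...; p_n]) *)
Definition gpath := {p : G * seq G | path (@arrow G) p.1 p.2}.
HB.instance Definition _ := Countable.on gpath.

Implicit Types p q : gpath.

Definition source p : G := (val p).1.
Definition target p : G := last (val p).1 (val p).2.
Definition plen p : nat := size (val p).2.

Definition path0 (x : G) : gpath := exist _ (x, [::]) isT.

(* the [insub] always succeeds, see [pcatP] below *)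
Definition pcat p q : option gpath :=
  if target p == source q then (insub (source p, (val p).2 ++ (val q).2) : option gpath)
  else None.

Lemma pcatP p q : target p = source q ->
  exists2 r, pcat p q = Some r & val r = (source p, (val p).2 ++ (val q).2).
Proof.
move=> pq; rewrite /pcat pq eqxx; case: insubP => [r _ rE|]; first by exists r.
by rewrite /= cat_path (valP p) -[last _ _]/(target p) pq (valP q).
Qed.

Definition path_length_between (x y : G) : pred nat := fun n =>
  `[< exists p, [/\ source p = x, target p = y & plen p = n] >].

(* [None] stands for infinity *)
Definition dist (x y : G) : option nat :=
  if pselect (exists n, path_length_between x y n) is left h
  then Some (ex_minn h) else None.

Definition shortest p : bool := dist (source p) (target p) == Some (plen p).

Definition oaddn (a b : option nat) : option nat :=
  if (a, b) is (Some m, Some n) then Some (m + n)%N else None.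

Definition seqlen (s : seq G) : option nat :=
  if s is x :: s' then foldr oaddn (Some 0) (pairmap dist x s') else Some 0.

End Paths.

Section MagnitudeHomology.
Variables (K : comPzRingType) (G : digraph).

Definition mtuple (n l : nat) :=
  {t : n.+1.-tuple G | sorted (fun x y => x != y) t && (seqlen t == Some l)}.
HB.instance Definition _ n l := Countable.on (mtuple n l).

Definition MC n l := freemod K (mtuple n l).
HB.instance Definition _ n l := GRing.Lmodule.on (MC n l).

Definition del n (i : 'I_n.+2) (t : n.+2.-tuple G) : n.+1.-tuple G :=
  [tuple tnth t (lift i j) | j < n.+1].

(* The condition that consecutive vertices of [del i t] be distinct is implied by
   the condition on the length: if x_{i-1} = x_{i+1}, deleting x_i decreases it. *)
Definition face n l (i : 'I_n.+2) (t : mtuple n.+1 l) : MC n l :=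
  oapp basis 0 (insub (del i (val t)) : option (mtuple n l)).

Definition bdry n l : MC n.+1 l -> MC n l :=
  flift (fun t => \sum_(i < n.+2) (-1) ^+ i *: face i t).
HB.instance Definition _ n l := GRing.Linear.on (@bdry n l).

(* as MC_{-1} = 0, all 0-chains are cycles *)
Definition cycles n l : submodClosed (MC n l) :=
  match n with 0 => fullm | m.+1 => kerm (@bdry m l) end.

Definition homology l (C : forall m, submodClosed (MC m l)) n : lmodType K :=
  subquot (capm (cycles n l) (C n)) (imagem (@bdry n l) (C n.+1)).

Definition MCfull l m : submodClosed (MC m l) := fullm.

Definition MCxy (x y : G) l m : submodClosed (MC m l) :=
  span [set basis t | t in [set t : mtuple m l | thead (val t) = x
                                              /\ last x (val t) = y]].

Definition MH n l : lmodType K := homology (MCfull l) n.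
Definition MHxy x y n l : lmodType K := homology (MCxy x y l) n.

Fact MHxy_cycles x y n l :
  {subset capm (cycles n l) (MCxy x y l n) <= capm (cycles n l) (MCfull l n)}.
Proof. by move=> u /andP[uZ _]; apply/andP. Qed.

Fact MHxy_bdrys x y n l :
  {subset imagem (@bdry n l) (MCxy x y l n.+1) <= imagem (@bdry n l) (MCfull l n.+1)}.
Proof. by move=> u /asboolP[v _ ->]; apply/asboolP; exists v. Qed.

Definition MHgr n : gradedModule K := dsum_graded (MH n).
Definition MHxygr n (xy : G * G) : gradedModule K := dsum_graded (MHxy xy.1 xy.2 n).

Definition MHxy_incl n (xy : G * G) : MHxygr n xy -> MHgr n :=
  dsum_map (fun l => subquot_incl (@MHxy_cycles xy.1 xy.2 n l)
                                  (@MHxy_bdrys xy.1 xy.2 n l)).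

End MagnitudeHomology.

Section PathAlgebra.
Variables (K : comPzRingType) (G : digraph).

Definition pathalg := freemod K (gpath G).
HB.instance Definition _ := GRing.Lmodule.on pathalg.

Implicit Types (u v w : pathalg) (p q r : gpath G).

Definition pmul p q : pathalg := oapp basis 0 (pcat p q).
Definition pathalg_mul u v : pathalg := flift (fun p => flift (pmul p) v) u.
Definition pathalg_id (x : G) : pathalg := basis (path0 x).
Definition pathalg_one : pathalg := \sum_(x : G) pathalg_id x.

Lemma pathalg_mul_linl v : linear (pathalg_mul^~ v).
Proof. by move=> a u w; rewrite /pathalg_mul linearP. Qed.

Lemma pathalg_mul_linr u : linear (pathalg_mul u).
Proof.
move=> a v w; have [A uA] := freemod_supp u.
rewrite /pathalg_mul !(fliftE _ uA) scaler_sumr -big_split.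
apply: eq_bigr => p _ /=; rewrite linearP scalerDr; congr (_ + _).
by rewrite !scalerA mulrC.
Qed.

Lemma pathalg_mul_basis p q : pathalg_mul (basis p) (basis q) = pmul p q.
Proof. by rewrite /pathalg_mul !flift_basis. Qed.

Lemma pcat_assoc p q r :
  obind (fun s => pcat s r) (pcat p q) = obind (pcat p) (pcat q r).
Proof.
have [pq|pq] := eqVneq (target p) (source q); last first.
  have -> : pcat p q = None by rewrite /pcat (negbTE pq).
  have [qr|qr] := eqVneq (target q) (source r); last first.
    by rewrite /pcat (negbTE qr).
  have [s -> sE] := pcatP qr; rewrite /= /pcat.
  have -> : source s = source q by rewrite /source sE.
  by rewrite (negbTE pq).
have [s Es sE] := pcatP pq; rewrite Es /=.
have ts : target s = target q.
  by rewrite /target sE /= last_cat -[last (source p) _]/(target p) pq.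
have [qr|qr] := eqVneq (target q) (source r); last first.
  by rewrite /pcat ts (negbTE qr).
have [t Et tE] := pcatP qr; rewrite Et /=.
have [|a -> aE] := @pcatP G s r; first by rewrite ts.
have [|b -> bE] := @pcatP G p t; first by rewrite pq /source tE.
by congr Some; apply: val_inj; rewrite aE bE /source sE tE /= catA.
Qed.

Lemma pathalg_mul0 u : pathalg_mul 0 u = 0.
Proof. exact: linear0. Qed.

Lemma pathalg_mulr0 u : pathalg_mul u 0 = 0.
Proof.
have := pathalg_mul_linr u 1 0 0; rewrite scaler0 addr0 scale1r => /esym/eqP.
by rewrite -subr_eq0 addrK => /eqP.
Qed.

Lemma pathalg_mulA : associative pathalg_mul.
Proof.
move=> u v w.
apply: (freemod_lin_ext (f := fun u => pathalg_mul u (pathalg_mul v w))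
  (g := fun u => pathalg_mul (pathalg_mul u v) w)).
- exact: pathalg_mul_linl.
- by move=> a u1 u2; rewrite !pathalg_mul_linl.
move=> p; apply: (freemod_lin_ext
  (f := fun v => pathalg_mul (basis p) (pathalg_mul v w))
  (g := fun v => pathalg_mul (pathalg_mul (basis p) v) w)).
- by move=> a u1 u2; rewrite pathalg_mul_linl pathalg_mul_linr.
- by move=> a u1 u2; rewrite pathalg_mul_linr pathalg_mul_linl.
move=> q; apply: (freemod_lin_ext
  (f := fun w => pathalg_mul (basis p) (pathalg_mul (basis q) w))
  (g := fun w => pathalg_mul (pathalg_mul (basis p) (basis q)) w)).
- by move=> a u1 u2; rewrite !pathalg_mul_linr.
- exact: pathalg_mul_linr.
move=> r; rewrite !pathalg_mul_basis /pmul.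
have := pcat_assoc p q r; case: (pcat p q) => [s|] /=; case: (pcat q r) => [t|] /= E;
  rewrite ?pathalg_mul_basis ?pathalg_mul0 ?pathalg_mulr0 //.
- by rewrite /pmul E.
- by rewrite /pmul E.
- by rewrite /pmul -E.
Qed.

Lemma pathalg_mulDl : left_distributive pathalg_mul +%R.
Proof. by move=> u v w; rewrite /pathalg_mul linearD. Qed.

Lemma pathalg_mulDr : right_distributive pathalg_mul +%R.
Proof.
by move=> u v w; rewrite -[v in LHS]scale1r pathalg_mul_linr scale1r.
Qed.

Lemma path0_mul x p :
  pathalg_mul (pathalg_id x) (basis p) = if x == source p then basis p else 0.
Proof.
rewrite pathalg_mul_basis /pmul; have [xp|xp] := eqVneq x (source p); last first.
  by rewrite /pcat (negbTE xp).
have [r -> rE] := @pcatP _ (path0 x) p xp; congr basis.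
by apply: val_inj; rewrite rE /source /= xp /source -surjective_pairing.
Qed.

Lemma mul_path0 x p :
  pathalg_mul (basis p) (pathalg_id x) = if target p == x then basis p else 0.
Proof.
rewrite pathalg_mul_basis /pmul; have [px|px] := eqVneq (target p) x; last first.
  by rewrite /pcat (negbTE px).
have [r -> rE] := @pcatP _ p (path0 x) px; congr basis.
by apply: val_inj; rewrite rE /= cats0 /source -surjective_pairing.
Qed.

Lemma pathalg_mul1l : left_id pathalg_one pathalg_mul.
Proof.
apply: freemod_lin_ext => [a u u'|//|p]; first exact: pathalg_mul_linr.
rewrite /pathalg_one [LHS]linear_sum.
rewrite (bigD1 (source p)) //= [X in X + _]path0_mul eqxx big1 ?addr0 // => x xp.
by rewrite [LHS]path0_mul (negbTE xp).
Qed.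

Lemma pathalg_mul1r : right_id pathalg_one pathalg_mul.
Proof.
apply: freemod_lin_ext => [a u u'|//|p]; first exact: pathalg_mul_linl.
rewrite /pathalg_one /pathalg_mul flift_basis [LHS]linear_sum /=.
have E x : flift (pmul p) (pathalg_id x) = if target p == x then basis p else 0.
  by rewrite -mul_path0 /pathalg_mul flift_basis.
rewrite (bigD1 (target p)) //= E eqxx big1 ?addr0 // => x xp.
by rewrite E eq_sym (negbTE xp).
Qed.

HB.instance Definition _ := GRing.Zmodule_isPzRing.Build pathalg
  pathalg_mulA pathalg_mul1l pathalg_mul1r pathalg_mulDl pathalg_mulDr.

(* The library structures of algebras require 1 <> 0, which fails for [pathalg] when
   K = 0 or G is empty. *)
Lemma pathalg_scalerAl (a : K) u v : a *: (u * v) = (a *: u) * v.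
Proof. by have /esym := pathalg_mul_linl v a u 0; rewrite pathalg_mul0 !addr0. Qed.

Lemma pathalg_scalerAr (a : K) u v : a *: (u * v) = u * (a *: v).
Proof. by have /esym := pathalg_mul_linr u a v 0; rewrite pathalg_mulr0 !addr0. Qed.

Definition corner (x y : G) u : pathalg := pathalg_id x * u * pathalg_id y.

Lemma corner_linear x y : linear (corner x y).
Proof.
move=> a u v; rewrite /corner mulrDr mulrDl; congr (_ + _).
by rewrite -pathalg_scalerAr -pathalg_scalerAl.
Qed.
HB.instance Definition _ x y :=
  GRing.isLinear.Build K pathalg pathalg _ (corner x y) (corner_linear x y).

Definition pathalg_deg (l : nat) : {pred pathalg} :=
  span [set basis p | p in [set p : gpath G | plen p = l]].

End PathAlgebra.

HB.mixin Record isTwoSided (K : comPzRingType) (G : digraph)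
    (S : pathalg K G -> bool) := {
  idealMl : forall a u, u \in S -> a * u \in S;
  idealMr : forall a u, u \in S -> u * a \in S
}.

#[short(type="pathIdeal")]
HB.structure Definition PathIdeal (K : comPzRingType) (G : digraph) :=
  {S of @GRing.SubmodClosed K (pathalg K G) S & isTwoSided K G S}.

Section Ideals.
Context {K : comPzRingType} {G : digraph}.
Local Notation A := (pathalg K G).
Implicit Types I J : pathIdeal K G.

Lemma span_mulP (S : set A) :
  (forall a s, S s -> a * s \in span S) -> (forall a s, S s -> s * a \in span S) ->
  forall a u, u \in span S -> (a * u \in span S) /\ (u * a \in span S).
Proof.
move=> Sl Sr a u /asboolP[n [c [s [Ss ->]]]]; rewrite mulr_sumr mulr_suml.
split; apply: rpred_sum => i _.
  by rewrite -pathalg_scalerAr rpredZ // Sl.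
by rewrite -pathalg_scalerAl rpredZ // Sr.
Qed.

Fact fullm_idealMl (a u : A) : u \in fullm -> a * u \in fullm. Proof. by []. Qed.
Fact fullm_idealMr (a u : A) : u \in fullm -> u * a \in fullm. Proof. by []. Qed.
HB.instance Definition _ :=
  isTwoSided.Build K G (@fullm K A) fullm_idealMl fullm_idealMr.

Fact capm_idealMl I J (a u : A) : u \in capm I J -> a * u \in capm I J.
Proof. by case/andP => uI uJ; apply/andP; split; apply: idealMl. Qed.
Fact capm_idealMr I J (a u : A) : u \in capm I J -> u * a \in capm I J.
Proof. by case/andP => uI uJ; apply/andP; split; apply: idealMr. Qed.
HB.instance Definition _ I J :=
  isTwoSided.Build K G (capm I J) (@capm_idealMl I J) (@capm_idealMr I J).

Fact addm_idealMl I J (a u : A) : u \in addm I J -> a * u \in addm I J.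
Proof.
case/asboolP => v [w [vI wJ ->]]; apply/asboolP; exists (a * v), (a * w).
by rewrite mulrDr !idealMl.
Qed.
Fact addm_idealMr I J (a u : A) : u \in addm I J -> u * a \in addm I J.
Proof.
case/asboolP => v [w [vI wJ ->]]; apply/asboolP; exists (v * a), (w * a).
by rewrite mulrDl !idealMr.
Qed.
HB.instance Definition _ I J :=
  isTwoSided.Build K G (addm I J) (@addm_idealMl I J) (@addm_idealMr I J).

Definition idealgen (S : set A) : {pred A} :=
  span [set u | exists a b s, S s /\ u = a * s * b].
HB.instance Definition _ S := GRing.SubmodClosed.on (idealgen S).
Fact idealgen_mul S (a u : A) :
  u \in idealgen S -> (a * u \in idealgen S) /\ (u * a \in idealgen S).
Proof.
apply: span_mulP => {a u} c _ [a [b [s [Ss ->]]]]; apply: mem_span.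
  by exists (c * a), b, s; rewrite !mulrA.
by exists a, (b * c), s; rewrite !mulrA.
Qed.
HB.instance Definition _ S := isTwoSided.Build K G (idealgen S)
  (fun a u uS => (idealgen_mul a uS).1) (fun a u uS => (idealgen_mul a uS).2).

Definition idealM (I J : {pred A}) : {pred A} :=
  span [set u | exists a b, [/\ a \in I, b \in J & u = a * b]].
HB.instance Definition _ I J := GRing.SubmodClosed.on (idealM I J).
Fact idealM_mul I J (a u : A) :
  u \in idealM I J -> (a * u \in idealM I J) /\ (u * a \in idealM I J).
Proof.
apply: span_mulP => {a u} c _ [a [b [aI bJ ->]]]; apply: mem_span.
  by exists (c * a), b; rewrite idealMl // mulrA.
by exists a, (b * c); rewrite idealMr // mulrA.
Qed.
HB.instance Definition _ I J := isTwoSided.Build K G (idealM I J)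
  (fun a u uS => (idealM_mul a uS).1) (fun a u uS => (idealM_mul a uS).2).

Fixpoint idealX (I : pathIdeal K G) (n : nat) : pathIdeal K G :=
  if n is m.+1 then idealM I (idealX I m) else fullm.

Definition idealxy (x y : G) (I : {pred A}) : {pred A} := imagem (corner x y) I.
HB.instance Definition _ x y I := GRing.SubmodClosed.on (idealxy x y I).

Lemma idealxy_sub x y I : {subset idealxy x y I <= I}.
Proof. by move=> _ /asboolP[u uI ->]; rewrite idealMr ?idealMl. Qed.

Lemma idealxy_mono x y I J : {subset I <= J} -> {subset idealxy x y I <= J}.
Proof. by move=> IJ u /idealxy_sub /IJ. Qed.

Definition subquot_graded (B C : submodClosed A) : gradedModule K :=
  @GradedModule K (subquot B C)
    (fun l => [set cls B C u | u in [set u | u \in B /\ u \in pathalg_deg l]]).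

End Ideals.

Section RelationIdeal.
Variables (K : comPzRingType) (G : digraph).

Definition Jideal : pathIdeal K G :=
  idealgen [set basis p | p in [set p : gpath G | (1 <= plen p)%N]].

Definition Rgen : set (pathalg K G) :=
  [set u | exists p q : gpath G, [/\ shortest p, shortest q,
      source p = source q, target p = target q & u = basis p - basis q]]
  `|` [set basis p | p in [set p : gpath G | ~~ shortest p]].

Definition Rideal : pathIdeal K G := idealgen Rgen.

Local Notation J := Jideal.
Local Notation R := Rideal.
Local Notation "I ':*:' I'" := (idealM I I') (at level 40, left associativity).
Local Notation "R ':^:' n" := (idealX R n) (at level 30).

Definition even_num (n : nat) : pathIdeal K G :=
  if n is m.+1 then capm (R :^: n) (J :*: R :^: m :*: J) else fullm.
Definition even_den (n : nat) : pathIdeal K G :=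
  addm (J :*: R :^: n) (R :^: n :*: J).
Definition odd_num (n : nat) : pathIdeal K G :=
  capm (J :*: R :^: n) (R :^: n :*: J).
Definition odd_den (n : nat) : pathIdeal K G :=
  addm (R :^: n.+1) (J :*: R :^: n :*: J).

Lemma idealgen_min (S : set (pathalg K G)) (I : pathIdeal K G) :
  (forall s, S s -> s \in I) -> {subset idealgen S <= I}.
Proof.
move=> SI _ /asboolP[m [c [s [Ss ->]]]]; apply: rpred_sum => i _.
by have [a [b [t [St ->]]]] := Ss i; rewrite rpredZ // idealMr // idealMl // SI.
Qed.

Lemma mem_idealgen (S : set (pathalg K G)) s : S s -> s \in idealgen S.
Proof. by move=> Ss; apply: mem_span; exists 1, 1, s; rewrite mul1r mulr1. Qed.

Lemma idealMS (I1 I2 I3 I4 : pathIdeal K G) : {subset I1 <= I3} ->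
  {subset I2 <= I4} -> {subset I1 :*: I2 <= I3 :*: I4}.
Proof.
move=> I13 I24 _ /asboolP[m [c [s [Ss ->]]]]; apply: rpred_sum => i _.
have [a [b [aI bI ->]]] := Ss i; rewrite rpredZ //; apply: mem_span.
by exists a, b; rewrite I13 // I24.
Qed.

Lemma idealM_subl (I1 I2 : pathIdeal K G) : {subset I1 :*: I2 <= I1}.
Proof.
move=> _ /asboolP[m [c [s [Ss ->]]]]; apply: rpred_sum => i _.
by have [a [b [aI bI ->]]] := Ss i; rewrite rpredZ // idealMr.
Qed.

Lemma idealM_subr (I1 I2 : pathIdeal K G) : {subset I1 :*: I2 <= I2}.
Proof.
move=> _ /asboolP[m [c [s [Ss ->]]]]; apply: rpred_sum => i _.
by have [a [b [aI bI ->]]] := Ss i; rewrite rpredZ // idealMl.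
Qed.

Lemma idealMA (I1 I2 I3 : pathIdeal K G) :
  I1 :*: (I2 :*: I3) =i I1 :*: I2 :*: I3.
Proof.
move=> u; apply/idP/idP => /asboolP[m [c [s [Ss ->]]]]; apply: rpred_sum => i _.
  have [a [_ [aI /asboolP[k [d [t [St ->]]]] ->]]] := Ss i.
  rewrite rpredZ // mulr_sumr rpred_sum // => j _.
  have [b [e [bI eI ->]]] := St j; rewrite -pathalg_scalerAr rpredZ // mulrA.
  apply: mem_span; exists (a * b), e; split => //.
  by apply: mem_span; exists a, b.
have [_ [a [/asboolP[k [d [t [St ->]]]] aI ->]]] := Ss i.
rewrite rpredZ // mulr_suml rpred_sum // => j _.
have [b [e [bI eI ->]]] := St j; rewrite -pathalg_scalerAl rpredZ // -mulrA.
apply: mem_span; exists b, (e * a); split => //.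
by apply: mem_span; exists e, a.
Qed.

Lemma idealXSr (I : pathIdeal K G) m : I :^: m.+1 =i I :^: m :*: I.
Proof.
elim: m => [|m IH] u.
  apply/idP/idP => [/idealM_subl|/idealM_subr] uI; apply: mem_span.
    by exists 1, u; rewrite mul1r.
  by exists u, 1; rewrite mulr1.
rewrite -[RHS]/(u \in I :*: (I :^: m) :*: I) -idealMA.
by apply/idP/idP; apply: idealMS => // v; rewrite -IH.
Qed.

Lemma Rideal_sub_J : {subset R <= J}.
Proof.
have dist0 (p : gpath G) : plen p = 0 -> p = path0 (source p).
  by case: p => -[x [|y s]] //= h _; apply: val_inj.
have distxx (x : G) : dist x x = Some 0.
  have xx0 : path_length_between x x 0 by apply/asboolP; exists (path0 x).
  rewrite /dist; case: pselect => [h|]; last by case; exists 0.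
  by case: ex_minnP => m _ /(_ _ xx0); rewrite leqn0 => /eqP ->.
have inJ (p : gpath G) : plen p <> 0 -> basis p \in J.
  by move=> p0; apply: mem_idealgen; exists p => //=; case: (plen p) p0.
apply: idealgen_min => _ [[p [q [ps qs pq1 pq2 ->]]]|[p /negP pl <-]].
  have pq : plen p = plen q.
    by move: ps qs; rewrite /shortest pq1 pq2 => /eqP -> /eqP[->].
  have [p0|p0] := pselect (plen p = 0); last by rewrite rpredB ?inJ -?pq.
  by rewrite (dist0 p) // (dist0 q) -?pq // pq1 subrr rpred0.
apply: inJ => p0; apply: pl; rewrite /shortest p0 (dist0 p p0).
by rewrite /source /target /= distxx.
Qed.

(* the quotients [even_num / even_den] and [odd_num / odd_den] make sense *)
Lemma even_den_sub n : {subset even_den n <= even_num n}.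
Proof.
case: n => [//|n] _ /asboolP[u [v [uI vI ->]]].
have RJ : {subset R :^: n.+1 <= R :^: n :*: J}.
  by move=> w; rewrite idealXSr; apply: idealMS => //; apply: Rideal_sub_J.
apply: rpredD; apply/andP; split.
- exact: idealM_subr uI.
- suff : u \in J :*: R :^: n :*: J by [].
  by rewrite -idealMA; apply: idealMS RJ _ uI.
- exact: idealM_subl vI.
- by apply: idealMS vI => // w; apply: idealMS => //; apply: Rideal_sub_J.
Qed.

Lemma odd_den_sub n : {subset odd_den n <= odd_num n}.
Proof.
move=> _ /asboolP[u [v [uI vI ->]]]; apply: rpredD; apply/andP; split.
- by apply: idealMS uI => //; apply: Rideal_sub_J.
- by move: uI; rewrite idealXSr; apply: idealMS => //; apply: Rideal_sub_J.
- exact: idealM_subl vI.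
- by move: vI; rewrite -idealMA => /idealM_subr.
Qed.

End RelationIdeal.

Section IdealQuotient.
Context {K : comPzRingType} {G : digraph}.
Variables (I I' : pathIdeal K G).

(* I / I' and e_x I e_y / e_x I' e_y *)
Definition iquot : gradedModule K := subquot_graded I I'.
Definition iquotxy (xy : G * G) : gradedModule K :=
  subquot_graded (idealxy xy.1 xy.2 I) (idealxy xy.1 xy.2 I').

Definition iquotxy_incl (xy : G * G) : iquotxy xy -> iquot :=
  subquot_incl (@idealxy_sub K G xy.1 xy.2 I) (@idealxy_sub K G xy.1 xy.2 I').

End IdealQuotient.

(* Main.v *)
Require Import Defs.
From mathcomp Require Import all_boot all_order all_algebra all_classical.
From HB Require Import structures.
From mathcomp Require Import finmap zify ssrAC all_classical.
Import Defs.

(** Write [T] for the path algebra, [A = T / R], and [S] for the span of the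
    vertices.  Modulo [R] a long path is zero and a shortest path is determined
    by its end points, so [A] has a basis of pairs [(x, y)] at finite distance,
    with [(x, y) (y, z) = (x, z)] if [y] lies on a geodesic from [x] to [z] and
    zero otherwise.  A tuple [(x_0, ..., x_m)] is thus a bar element
    [[a_1 | ... | a_m]] with [a_i = (x_(i-1), x_i)], and the magnitude differential
    is the bar differential: the magnitude complex is the normalized bar complex
    of [A] over [S].  The right-hand sides are the classical description of
    [Tor^A(S, S)] through the powers of [R], with [G_(2n) = R^n] and
    [G_(2n+1) = J R^n]: numerators are [G_m] intersected with [G_(m-1) J], and
    denominators are [G_(m+1) + G_m J].  Two resolutions of [S] are being compared,
    the bar resolution and the one with terms [G_m / G_m R]; after tensoring with [S]
    the comparison maps and the homotopy become explicit, as follows.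

    Choose a shortest path [geod x y] for every pair at finite distance, and let
    [curv x y z] be [geod x y * geod y z], minus [geod x z] when [y] lies on a
    geodesic from [x] to [z].  It is an element of [R].  The map [phi] multiplies
    curvatures of consecutive triples, preceded by one [geod] in odd degree:
    [phi [a_1 | ... | a_(2n)] = curv(a_1, a_2) ... curv(a_(2n-1), a_(2n))].  The
    Bianchi identity [curv_bianchi] makes the sum [phi (bd c)] telescope, and gives
    [phi (bd c) = -+ phi c] modulo [G_m J] ([phi_bd_even], [phi_bd_odd]).  So [phi]
    sends cycles into the numerators and boundaries into the denominators.

    In the other direction [psi] cuts paths.  The image of a path under [psi (2n)]
    is the sum, over all ways to write it [p_1 v_1 ... p_n v_n] with arrows [v_i] and
    shortest paths [p_i] of positive length, of the tuple of cut points;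
    [psi (2n+1)] sums over the factorizations [v_0 p_1 v_1 ... p_n v_n].  Then [psi m]
    vanishes on [G_m J] ([psi_RJ], [psi_JRJ]), [bd (psi m z) = +- psi (m-1) z] on
    [G_m] ([bd_psi_even], [bd_psi_odd]), and [phi (psi m z) = z] modulo [G_m J] for
    [z] in [G_m] ([phi_psi_even], [phi_psi_odd]).  Finally [homotopy] exhibits
    [psi m \o phi] as homotopic to the identity.  Hence [phi] and [psi] induce inverse
    isomorphisms ([even_model], [odd_model], [magmap_graded_iso]).

    Both maps preserve the end points, and match the length of a path with the
    length of a tuple.  This gives at once the grading, the corner versions and the
    compatibility of the latter with the former. *)

Set Implicit Arguments.
Unset Strict Implicit.
Unset Printing Implicit Defensive.

Import GRing.Theory.

Local Open Scope classical_set_scope.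
Local Open Scope ring_scope.

(** * Induction on linear combinations *)

Section LinearClosed.
Context {K : pzRingType}.
Implicit Types V W : lmodType K.

(** The predicates that may be proved on generators only.  Equality of two linear
    maps and membership of the image in a submodule are the main instances. *)
Definition lin_closed V (Q : V -> Prop) :=
  Q 0 /\ forall a u v, Q u -> Q v -> Q (a *: u + v).

Lemma lin_closed_eq V W (f g : {linear V -> W}) : lin_closed (fun u => f u = g u).
Proof. by split=> [|a u v fu fv]; rewrite ?linear0 // !linearP fu fv. Qed.

Lemma lin_closed_mem V W (f : {linear V -> W}) (B : submodClosed W) :
  lin_closed (fun u => f u \in B).
Proof. by split=> [|a u v fu fv]; rewrite ?linear0 ?rpred0 // linearP rpredD ?rpredZ. Qed.

Lemma lin_closed_comp V W (f : {linear V -> W}) (Q : W -> Prop) :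
  lin_closed Q -> lin_closed (fun u => Q (f u)).
Proof.
move=> [Q0 QP]; split=> [|a u v fu fv]; first by rewrite linear0.
by rewrite linearP; apply: QP.
Qed.

Lemma lin_closed0 V : lin_closed (fun u : V => u = 0).
Proof. by split=> [//|a u1 u2 -> ->]; rewrite scaler0 addr0. Qed.

Lemma lin_closedB V (Q : V -> Prop) (u v : V) :
  lin_closed Q -> Q u -> Q v -> Q (u - v).
Proof. by move=> Ql Qu Qv; rewrite addrC -scaleN1r; apply: Ql.2. Qed.

Lemma lin_closedD V (Q : V -> Prop) (u v : V) :
  lin_closed Q -> Q u -> Q v -> Q (u + v).
Proof. by move=> Ql Qu Qv; rewrite -[u]scale1r; apply: Ql.2. Qed.

Lemma lin_closed_sum V (Q : V -> Prop) (I : Type) (r : seq I) (F : I -> V) :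
  lin_closed Q -> (forall i, Q (F i)) -> Q (\sum_(i <- r) F i).
Proof.
move=> [Q0 QP] QF; elim: r => [|i r IH]; rewrite ?big_nil // big_cons.
by rewrite -[F i]scale1r; apply: QP.
Qed.

Lemma span_ind V (S : set V) (Q : V -> Prop) : lin_closed Q ->
  (forall s, S s -> Q s) -> forall u, u \in span S -> Q u.
Proof.
move=> Ql QS u /asboolP[n [c [s [Ss ->]]]]; apply: lin_closed_sum => // i.
by rewrite -[_ *: _]addr0; apply: Ql.2; [exact: QS|exact: Ql.1].
Qed.

End LinearClosed.

(** * Supports in free modules *)

Section Support.
Context {K : pzRingType} {T : choiceType}.
Implicit Types (P : T -> Prop) (u v : freemod K T).

Lemma freemodPE a u v t : (a *: u + v) t = a *: u t + v t. Proof. by []. Qed.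

Definition supp P u := forall t, u t <> 0 -> P t.

Lemma supp_lin P : lin_closed (supp P).
Proof.
split=> [t /=|a u v uP vP t]; first by [].
rewrite freemodPE; have [vt0|/vP//] := pselect (v t = 0).
have [ut0|/uP//] := pselect (u t = 0).
by rewrite vt0 ut0 scaler0 addr0.
Qed.

Lemma supp0 P : supp P 0.
Proof. exact: (supp_lin P).1. Qed.

Lemma suppD P u v : supp P u -> supp P v -> supp P (u + v).
Proof. exact: lin_closedD (supp_lin P). Qed.

Lemma suppB P u v : supp P u -> supp P v -> supp P (u - v).
Proof. exact: lin_closedB (supp_lin P). Qed.

Lemma suppN P u : supp P u -> supp P (- u).
Proof. by move=> uP; rewrite -sub0r; apply: suppB => //; exact: supp0. Qed.

Lemma supp_basis P t : P t -> supp P (basis t : freemod K T).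
Proof. by move=> Pt s /=; case: eqP => // ->. Qed.

Lemma supp_ind P (Q : freemod K T -> Prop) : lin_closed Q ->
  (forall t, P t -> Q (basis t)) -> forall u, supp P u -> Q u.
Proof.
move=> Ql QP u uP; have [A uA] := freemod_supp u.
rewrite -(flift_id u) (fliftE _ uA); apply: lin_closed_sum => // t.
have [->|/uP Pt] := pselect (u t = 0); first by rewrite scale0r; exact: Ql.1.
by rewrite -[_ *: _]addr0; apply: Ql.2; [exact: QP|exact: Ql.1].
Qed.

Lemma freemod_ind (Q : freemod K T -> Prop) : lin_closed Q ->
  (forall t, Q (basis t)) -> forall u, Q u.
Proof. by move=> Ql Qb u; apply: (@supp_ind (fun=> True)) => // t _. Qed.

Lemma supp_sub P P' u : (forall t, P t -> P' t) -> supp P u -> supp P' u.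
Proof. by move=> PP' uP t /uP /PP'. Qed.

Lemma mem_span_basis P u : u \in span [set basis t | t in P] <-> supp P u.
Proof.
split=> [|uP].
  move: u; apply: span_ind; first exact: supp_lin.
  by move=> _ [t Pt <-]; apply: supp_basis.
move: u uP; apply: supp_ind => [|t Pt]; last by apply: mem_span; exists t.
by split=> [|a u v uS vS]; rewrite ?rpred0 // rpredD ?rpredZ.
Qed.

End Support.

(** * Distance and geodesics *)

Section Distance.
Variable G : digraph.
Implicit Types (x y z w : G) (p q r : gpath G).

Lemma dist_le p : exists2 k, dist (source p) (target p) = Some k & (k <= plen p)%N.
Proof.
have pp : path_length_between (source p) (target p) (plen p) by apply/asboolP; exists p.
rewrite /dist; case: pselect => [h|]; last by case; exists (plen p).
by exists (ex_minn h) => //; case: ex_minnP => m _ /(_ _ pp).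
Qed.

Lemma distP x y k : dist x y = Some k ->
  exists p, [/\ source p = x, target p = y & plen p = k].
Proof.
rewrite /dist; case: pselect => // h [<-].
by case: ex_minnP => m /asboolP.
Qed.

Lemma pcat_ex p q : target p = source q -> exists r,
  [/\ pcat p q = Some r, source r = source p, target r = target q &
      plen r = (plen p + plen q)%N].
Proof.
move=> pq; have [r -> rE] := pcatP pq; exists r; rewrite /source /target /plen rE /=.
split => //; last by rewrite size_cat.
by rewrite last_cat -[last (source p) _]/(target p) pq.
Qed.

Lemma dist_triangle x y z a b : dist x y = Some a -> dist y z = Some b ->
  exists2 c, dist x z = Some c & (c <= a + b)%N.
Proof.
move=> /distP[p [<- py pa]] /distP[q [qy <- qb]].
have [|r [_ <- <- rl]] := @pcat_ex p q; first by rewrite py qy.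
by have [c -> rc] := dist_le r; exists c => //; rewrite -pa -qb -rl.
Qed.

Lemma path0E p : plen p = 0%N -> p = path0 (source p).
Proof. by case: p => -[x [|y s]] //= h _; apply: val_inj. Qed.

Lemma distxx x : dist x x = Some 0%N.
Proof. by have [k dk] := dist_le (path0 x); rewrite leqn0 => /eqP k0; rewrite -k0 -dk. Qed.

Lemma dist_eq0 x y : dist x y = Some 0%N -> x = y.
Proof. by case/distP => p [<- <- /path0E ->]. Qed.

Lemma dist_gt0 x y k : x != y -> dist x y = Some k -> (0 < k)%N.
Proof. by case: k => // xy /dist_eq0 xy'; rewrite xy' eqxx in xy. Qed.

Lemma dist_arrow p : plen p = 1%N -> source p != target p /\
  dist (source p) (target p) = Some 1%N.
Proof.
case: p => -[x [|y [|? ?]]] // pth _.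
have xy : x != y.
  by apply: contraTneq pth => <- /=; rewrite arrow_irr.
split=> //; have [k dk] := dist_le (exist _ (x, [:: y]) pth : gpath G).
have := dist_gt0 xy dk; rewrite dk [plen _]/=.
by case: k {dk} => [|[]].
Qed.

(** [y] lies on a geodesic from [x] to [z]. *)
Definition between x y z := (dist x z != None) && (oaddn (dist x y) (dist y z) == dist x z).

Lemma betweenP x y z : reflect
  (exists a b, [/\ dist x y = Some a, dist y z = Some b & dist x z = Some (a + b)%N])
  (between x y z).
Proof.
rewrite /between; apply: (iffP andP) => [[]|[a [b [-> -> ->]]]] //.
case: (dist x y) => [a|] /=; last by move=> h /eqP h'; rewrite -h' eqxx in h.
case: (dist y z) => [b|] /=; last by move=> h /eqP h'; rewrite -h' eqxx in h.
by move=> _ /eqP <-; exists a, b.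
Qed.

(** Both sides say that [x, y, z, w] occur in this order on a geodesic.  This is the
    associativity of [KG / R]. *)
Lemma between_assoc x y z w :
  between y z w && between x y w = between x y z && between x z w.
Proof.
apply/andP/andP => -[/betweenP[a [b [ya yb yw]]] /betweenP[c [d [h1 h2 h3]]]].
  move: yw h3; rewrite h2 => -[->] xw.
  have [e xz ez] := dist_triangle h1 ya.
  have [f] := dist_triangle xz yb; rewrite xw => -[<-] le.
  have ecd : e = (c + a)%N by apply/eqP; rewrite eqn_leq ez; lia.
  split; apply/betweenP; first by exists c, a; rewrite -ecd.
  by exists e, b; split=> //; rewrite xw ecd addnA.
move: h1; rewrite yw => -[ce]; subst c.
have [e yw' ez] := dist_triangle yb h2.
have [f] := dist_triangle ya yw'; rewrite h3 => -[<-] le.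
have ecd : e = (b + d)%N by lia.
split; apply/betweenP; first by exists b, d; rewrite -ecd.
by exists a, e; split=> //; rewrite h3 ecd addnA.
Qed.

Lemma shortest_arrow p : plen p = 1%N -> shortest p.
Proof. by move=> p1; rewrite /shortest (dist_arrow p1).2 p1. Qed.

Lemma shortest_pcat p q r : target p = source q -> pcat p q = Some r ->
  shortest r = [&& shortest p, shortest q & between (source p) (target p) (target q)].
Proof.
move=> pq rE; have [r' []] := pcat_ex pq; rewrite rE => -[<-] rs rt rl.
rewrite /shortest rs rt rl.
have [a pa la] := dist_le p; have [b qb lb] := dist_le q.
rewrite -pq in qb *; have [c rc lc] := dist_triangle pa qb.
rewrite pa qb rc; apply/idP/and3P => [/eqP[cE]|[/eqP[aE] /eqP[bE] /betweenP]].
  have [aE bE] : a = plen p /\ b = plen q by lia.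
  rewrite aE bE !eqxx; split=> //; apply/betweenP; exists a, b.
  by rewrite pa qb rc cE aE bE.
by move=> [a' [b']]; rewrite pa qb rc => -[[<-] [<-] [->]]; rewrite aE bE.
Qed.

End Distance.

(** * The path algebra on its basis *)

Section PathAlgebraBasis.
Context {K : comPzRingType} {G : digraph}.
Local Notation T := (pathalg K G).
Implicit Types (x y z : G) (p q r v : gpath G) (u w : T).

Definition mulby w u : T := u * w.
Fact mulby_linear w : linear (mulby w).
Proof. by move=> a u1 u2; rewrite /mulby mulrDl -pathalg_scalerAl. Qed.
HB.instance Definition _ w := GRing.isLinear.Build K T T _ (mulby w) (mulby_linear w).

Definition bymul w u : T := w * u.
Fact bymul_linear w : linear (bymul w).
Proof. by move=> a u1 u2; rewrite /bymul mulrDr -pathalg_scalerAr. Qed.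
HB.instance Definition _ w := GRing.isLinear.Build K T T _ (bymul w) (bymul_linear w).

Lemma lin_closed_mulr w (Q : T -> Prop) : lin_closed Q -> lin_closed (fun u => Q (u * w)).
Proof. exact: (lin_closed_comp (mulby w)). Qed.

Lemma lin_closed_mull w (Q : T -> Prop) : lin_closed Q -> lin_closed (fun u => Q (w * u)).
Proof. exact: (lin_closed_comp (bymul w)). Qed.

Lemma mul_basis p q r : pcat p q = Some r -> (basis p : T) * basis q = basis r.
Proof. by move=> E; rewrite -[LHS]/(pathalg_mul _ _) pathalg_mul_basis /pmul E. Qed.

Lemma mul_basis0 p q : target p <> source q -> (basis p : T) * basis q = 0.
Proof.
move=> /eqP/negbTE E.
by rewrite -[LHS]/(pathalg_mul _ _) pathalg_mul_basis /pmul /pcat E.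
Qed.

Lemma mul_basis_ex p q : target p = source q -> exists r,
  [/\ (basis p : T) * basis q = basis r, source r = source p, target r = target q,
      plen r = (plen p + plen q)%N &
      shortest r = [&& shortest p, shortest q & between (source p) (target p) (target q)]].
Proof.
move=> pq; have [r [rE rs rt rl]] := pcat_ex pq; exists r; split=> //.
  exact: mul_basis.
exact: shortest_pcat.
Qed.

(** The arrows generate the path algebra on either side; the inductions on paths
    below use the factorization at the first or at the last arrow. *)
Lemma path_cons p : (0 < plen p)%N -> exists v q, [/\ plen v = 1%N, pcat v q = Some p,
  target v = source q & plen p = (plen q).+1].
Proof.
case: p => -[x [|y s]] //= h _; have /andP[xy ys] := h.
have vP : path (@arrow G) x [:: y] by rewrite /= xy.
exists (exist _ (x, [:: y]) vP), (exist _ (y, s) ys); split=> //.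
have [|r -> rE] := @pcatP G (exist _ (x, [:: y]) vP) (exist _ (y, s) ys) => //.
by congr Some; apply: val_inj; rewrite rE.
Qed.

Lemma path_rcons p : (0 < plen p)%N -> exists q v, [/\ plen v = 1%N, pcat q v = Some p,
  target q = source v & plen p = (plen q).+1].
Proof.
case: p => -[x s]; case/lastP: s => // s y h _; have := h.
rewrite rcons_path => /andP[xs sy].
have vP : path (@arrow G) (last x s) [:: y] by rewrite /= sy.
exists (exist _ (x, s) xs), (exist _ (last x s, [:: y]) vP).
split=> //; last by rewrite /plen size_rcons.
have [|r -> rE] := @pcatP G (exist _ (x, s) xs) (exist _ (last x s, [:: y]) vP) => //.
by congr Some; apply: val_inj; rewrite rE /= cats1.
Qed.

Definition pathp x y l p : Prop := [/\ source p = x, target p = y & plen p = l].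

Lemma supp_mul x y z l k u w : supp (pathp x y l) u -> supp (pathp y z k) w ->
  supp (pathp x z (l + k)%N) (u * w : T).
Proof.
move=> uP; move: w; apply: supp_ind => [|q [qy <- <-]].
  exact: lin_closed_mull (supp_lin _).
move: u uP; apply: supp_ind => [|p [<- py <-]].
  exact: lin_closed_mulr (supp_lin _).
have [|r [-> rs rt rl _]] := @mul_basis_ex p q; first by rewrite py qy.
by apply: supp_basis; rewrite /pathp.
Qed.

Lemma mul_neq y z u w : supp (fun p => target p = y) u -> supp (fun p => source p = z) w ->
  y <> z -> u * w = 0 :> T.
Proof.
move=> uP wP yz; move: w wP; apply: supp_ind => [|q qz].
  exact: (lin_closed_mull u (@lin_closed0 _ T)).
move: u uP; apply: supp_ind => [|p py].
  exact: (lin_closed_mulr (basis q) (@lin_closed0 _ T)).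
by apply: mul_basis0; rewrite py qz.
Qed.

Lemma mem_deg l u : u \in pathalg_deg l -> supp (fun p => plen p = l) u.
Proof. by move=> /mem_span_basis. Qed.

Lemma corner_basis x y p : corner x y (basis p : T) =
  if (source p == x) && (target p == y) then basis p else 0.
Proof.
rewrite /corner -[_ * _ as X in X * _]/(pathalg_mul _ _) path0_mul eq_sym.
case: (source p == x) => /=; last by rewrite mul0r.
by rewrite -[LHS]/(pathalg_mul _ _) mul_path0.
Qed.

Lemma corner_id x y u : supp (fun p => source p = x /\ target p = y) u -> corner x y u = u.
Proof.
move: u; apply: supp_ind; last by move=> p [<- <-]; rewrite corner_basis !eqxx.
exact: (lin_closed_eq (corner x y) idfun).
Qed.

(** A two-sided ideal contains the corners of its elements, so cutting out a
    corner of it only constrains the end points. *)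
Lemma mem_idealxy x y (I : pathIdeal K G) u :
  (u \in idealxy x y I) <-> u \in I /\ supp (fun p => source p = x /\ target p = y) u.
Proof.
split=> [uI|[uI uP]]; last first.
  by apply/asboolP; exists u => //; rewrite corner_id.
split; first exact: idealxy_sub uI.
move: uI => /asboolP[w _ ->]; move: w; apply: freemod_ind.
  exact: (lin_closed_comp (corner x y) (supp_lin _)).
move=> p; rewrite corner_basis; case: ifP => [/andP[/eqP <- /eqP <-]|_].
  exact: supp_basis.
exact: supp0.
Qed.

End PathAlgebraBasis.

(** * The ideals J and R, and the curvature of a choice of geodesics *)

Section IdealInduction.
Context {K : comPzRingType} {G : digraph}.
Local Notation T := (pathalg K G).
Local Notation bp p := (basis p : pathalg K G).
Local Notation J := (Jideal K G).
Local Notation R := (Rideal K G).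
Implicit Types (x y z : G) (p q r v : gpath G) (u w : T) (I : pathIdeal K G).

Lemma mem_J p : (0 < plen p)%N -> bp p \in J.
Proof. by move=> p0; apply: mem_idealgen; exists p. Qed.

Lemma J_ind (Q : T -> Prop) : lin_closed Q ->
  (forall p, (0 < plen p)%N -> Q (bp p)) -> forall u, u \in J -> Q u.
Proof.
move=> Ql QP; apply: span_ind => // _ [a [b [_ [[p p0 <-] ->]]]].
have h c : Q (bp p * c).
  move: c; apply: freemod_ind; first exact: lin_closed_mull.
  move=> q; have [pq|pq] := pselect (target p = source q); last first.
    by rewrite mul_basis0 //; exact: Ql.1.
  have [r [-> _ _ rl _]] := @mul_basis_ex K G p q pq.
  by apply: QP; rewrite rl addn_gt0 p0.
rewrite -mulrA; move: a; apply: freemod_ind; first exact: lin_closed_mulr.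
move=> q; rewrite mulrA; have [pq|pq] := pselect (target q = source p); last first.
  by rewrite mul_basis0 // mul0r; exact: Ql.1.
have [r [-> _ _ rl _]] := @mul_basis_ex K G q p pq.
have r0 : (0 < plen r)%N by rewrite rl addn_gt0 [X in _ || X]p0 orbT.
move: b; apply: freemod_ind; first exact: lin_closed_mull.
move=> q'; have [pq'|pq'] := pselect (target r = source q'); last first.
  by rewrite mul_basis0 //; exact: Ql.1.
have [r' [-> _ _ rl' _]] := @mul_basis_ex K G r q' pq'.
by apply: QP; rewrite rl' addn_gt0 r0.
Qed.

Lemma idealM_ind I I' (Q : T -> Prop) : lin_closed Q ->
  (forall u w, u \in I -> w \in I' -> Q (u * w)) -> forall u, u \in idealM I I' -> Q u.
Proof. by move=> Ql QP; apply: span_ind => // _ [a [b [aI bI ->]]]; apply: QP. Qed.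

Lemma mem_idealM I I' u w : u \in I -> w \in I' -> u * w \in idealM I I'.
Proof. by move=> uI wI; apply: mem_span; exists u, w. Qed.

(** A path of positive length starts with an arrow, and the rest of it is absorbed
    by the ideal [I]. *)
Lemma JI_ind I (Q : T -> Prop) : lin_closed Q ->
  (forall v w, plen v = 1%N -> w \in I -> Q (bp v * w)) ->
  forall u, u \in idealM J I -> Q u.
Proof.
move=> Ql QP; apply: idealM_ind => // u w uJ wI; move: u uJ; apply: J_ind.
  exact: lin_closed_mulr.
move=> p /path_cons[v [q [v1 vq _ _]]]; rewrite -(mul_basis vq) -mulrA.
by apply: QP => //; apply: idealMl.
Qed.

Lemma plen_long p : ~~ shortest p -> (0 < plen p)%N.
Proof.
apply: contraR; rewrite -eqn0Ngt => /eqP p0; rewrite /shortest p0 (path0E p0).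
by rewrite /source /target /= distxx.
Qed.

Definition parallel p q := [/\ shortest p, shortest q, source p = source q & target p = target q].

Lemma parallel_plen p q : parallel p q -> plen p = plen q.
Proof. by case=> + + pq1 pq2; rewrite /shortest pq1 pq2 => /eqP -> /eqP[->]. Qed.

(** Multiplying the generators of [R] by paths yields nothing new: the relation of
    being parallel shortest paths is preserved or both products become long.  Thus
    [R] is spanned, without multiplying, by long paths and by differences of
    parallel shortest paths; the latter vanish when the length is zero. *)
Lemma R_ind (Q : T -> Prop) : lin_closed Q ->
  (forall p q, parallel p q -> (0 < plen p)%N -> Q (bp p - bp q)) ->
  (forall p, ~~ shortest p -> Q (bp p)) -> forall u, u \in R -> Q u.
Proof.
move=> Ql QS QL.
have QS' p q : source p = source q -> target p = target q -> plen p = plen q ->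
    Q (bp p - bp q).
  move=> pq1 pq2 pq3; have [ps|ps] := boolP (shortest p); last first.
    by apply: lin_closedB => //; apply: QL => //; rewrite /shortest -pq1 -pq2 -pq3.
  have qs : shortest q by rewrite /shortest -pq1 -pq2 -pq3.
  case: (posnP (plen p)) => [p0|]; last exact: QS.
  by rewrite (path0E p0) (@path0E _ q) -?pq3 // pq1 subrr; exact: Ql.1.
apply: span_ind => // _ [a [b [s [Rs ->]]]].
rewrite -mulrA; move: a; apply: freemod_ind; first exact: lin_closed_mulr.
move=> a; rewrite mulrA; move: b; apply: freemod_ind; first exact: lin_closed_mull.
move=> b; case: Rs => [[p [q [ps qs pq1 pq2 ->]]]|[p pl <-]].
  have pq3 : plen p = plen q by apply: parallel_plen.
  rewrite mulrBr mulrBl; have [ap|ap] := pselect (target a = source p); last first.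
    by rewrite !mul_basis0 -?pq1 // !mul0r subrr; exact: Ql.1.
  have [r [-> rs rt rl _]] := @mul_basis_ex K G a p ap.
  have [|r' [-> rs' rt' rl' _]] := @mul_basis_ex K G a q; first by rewrite -pq1.
  have [pb|pb] := pselect (target r = source b); last first.
    by rewrite !mul_basis0 ?rt' -?pq2 -?rt // subrr; exact: Ql.1.
  have [t [-> ts tt tl _]] := @mul_basis_ex K G r b pb.
  have [|t' [-> ts' tt' tl' _]] := @mul_basis_ex K G r' b; first by rewrite rt' -pq2 -rt.
  by apply: QS'; rewrite ?ts ?ts' ?rs ?rs' ?tt ?tt' // ?tl ?tl' rl rl' pq3.
have [ap|ap] := pselect (target a = source p); last first.
  by rewrite mul_basis0 // mul0r; exact: Ql.1.
have [r [-> rs rt rl rS]] := @mul_basis_ex K G a p ap.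
have [pb|pb] := pselect (target r = source b); last first.
  by rewrite mul_basis0 //; exact: Ql.1.
have [t [-> ts tt tl tS]] := @mul_basis_ex K G r b pb.
by apply: QL; rewrite tS rS (negbTE pl) !andbF.
Qed.

Lemma RI_ind I (Q : T -> Prop) : lin_closed Q ->
  (forall p q w, parallel p q -> (0 < plen p)%N -> w \in I ->
     Q (bp p * w - bp q * w)) ->
  (forall p w, ~~ shortest p -> w \in I -> Q (bp p * w)) ->
  forall u, u \in idealM R I -> Q u.
Proof.
move=> Ql QS QL; apply: idealM_ind => // u w uR wI; move: u uR; apply: R_ind.
- exact: lin_closed_mulr.
- by move=> p q pq p0; rewrite mulrBl; apply: QS.
- by move=> p pl; apply: QL.
Qed.

Lemma mem_R_parallel p q : parallel p q -> bp p - bp q \in R.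
Proof. by case=> ps qs h1 h2; apply: mem_idealgen; left; exists p, q. Qed.

Lemma mem_R_long p : ~~ shortest p -> bp p \in R.
Proof. by move=> pl; apply: mem_idealgen; right; exists p => //=; apply/negP. Qed.

(** A section of the projection from [KG] to [KG / R] on the basis of pairs at
    finite distance. *)
Definition geod x y : T :=
  if pselect (exists p, [&& source p == x, target p == y & shortest p]) is left h
  then basis (xchoose h) else 0.

Lemma geodP x y k : dist x y = Some k -> exists p,
  [/\ geod x y = bp p, source p = x, target p = y, plen p = k & shortest p].
Proof.
move=> xyk; rewrite /geod; case: pselect => [h|[]]; last first.
  have [p [px py pk]] := distP xyk; exists p.
  by rewrite px py !eqxx /shortest px py xyk pk eqxx.
exists (xchoose h); have /and3P[/eqP hx /eqP hy hs] := xchooseP h; split=> //.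
by move: hs; rewrite /shortest hx hy xyk => /eqP[].
Qed.

Lemma geod_inf x y : dist x y = None -> geod x y = 0.
Proof.
rewrite /geod; case: pselect => [h|//]; have /and3P[/eqP hx /eqP hy] := xchooseP h.
by rewrite /shortest hx hy => /eqP ->.
Qed.

Lemma geod_supp x y : supp (fun p => pathp x y (odflt 0%N (dist x y)) p) (geod x y).
Proof.
case E: (dist x y) => [k|]; last by rewrite geod_inf //; exact: supp0.
by have [p [-> px py pk _]] := geodP E; apply: supp_basis.
Qed.

Lemma geodJ x y : x != y -> geod x y \in J.
Proof.
move=> xy; case E: (dist x y) => [k|]; last by rewrite geod_inf ?rpred0.
by have [p [-> _ _ pk _]] := geodP E; apply: mem_J; rewrite pk (dist_gt0 xy E).
Qed.

Lemma geod_arrow v : plen v = 1%N -> geod (source v) (target v) = bp v.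
Proof.
move=> v1; have [_ d1] := dist_arrow v1.
have [p [-> px py pk _]] := geodP d1; congr basis; apply: val_inj.
case: p px py pk => -[a s] ha; case: v v1 {d1} => -[b t] hb.
case: t hb => [|b1 [|b2 t]] hb // _; case: s ha => [|a1 [|a2 s]] ha //=.
by rewrite {1}/source {1}/target /= => ea eb _; rewrite ea eb.
Qed.

(** The failure of [geod] to be multiplicative.  It plays the part of a curvature,
    [geod] being the connection. *)
Definition curv x y z : T :=
  geod x y * geod y z - (if between x y z then geod x z else 0).

(** When [y] is on a geodesic, both terms are shortest paths with the same end
    points; otherwise the product is long. *)
Lemma curvR x y z : curv x y z \in R.
Proof.
have nb : dist x y = None \/ dist y z = None -> between x y z = false.
  by case=> E; apply/negP => /betweenP[a [b []]]; rewrite E.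
rewrite /curv; case Exy: (dist x y) => [k|]; last first.
  by rewrite (nb (or_introl Exy)) geod_inf // mul0r subr0 rpred0.
case Eyz: (dist y z) => [l|]; last first.
  by rewrite (nb (or_intror Eyz)) (geod_inf Eyz) mulr0 subr0 rpred0.
have [p [-> px py pk ps]] := geodP Exy; have [q [-> qx qy ql qs]] := geodP Eyz.
have [|r [-> rx ry rl rs]] := @mul_basis_ex K G p q; first by rewrite py qx.
move: rs; rewrite ps qs px py qy /= => rs; case: ifP => xyz; last first.
  by rewrite subr0; apply: mem_R_long; rewrite rs xyz.
have /betweenP[a [b [_ _ xz]]] := xyz.
have [t [-> tx ty _ ts]] := geodP xz.
by apply: mem_R_parallel; split; rewrite ?rs ?rx ?ry ?tx ?ty.
Qed.

(** Associativity of the product of three geodesics, rewritten in terms of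
    curvatures. *)
Lemma curv_bianchi (x y z w : G) :
  (if between x y z then curv x z w else 0) - (if between y z w then curv x y w else 0)
  = geod x y * curv y z w - curv x y z * geod z w.
Proof.
have e (V : zmodType) (a b c d : V) : (b - d) - (c - d) = (a - c) - (a - b).
  by rewrite !opprB addrA subrK [RHS]addrC addrA subrK.
rewrite /curv mulrBr mulrBl mulrA.
rewrite -(e _ _ _ _ (if between x y z && between x z w then geod x w else 0)).
congr (_ - _); last rewrite -between_assoc.
  by case: (between x y z); rewrite ?mul0r ?subr0.
by case: (between y z w); rewrite ?mulr0 ?subr0.
Qed.

End IdealInduction.

(** * The bar differential on lists of vertices *)

Section Chains.
Context {K : comPzRingType} {G : digraph}.
Local Notation T := (pathalg K G).
Local Notation J := (Jideal K G).
Local Notation R := (Rideal K G).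
Local Notation bp p := (basis p : pathalg K G).
Implicit Types (x y z w : G) (p q r v : gpath G) (s t : seq G).

(** Chains of all degrees and lengths at once, on arbitrary lists of vertices: the
    degree of a list is its size minus one.  This avoids dependent types in the
    recursions; lists that are not generators of the magnitude complex are
    excluded by [chainp] where it matters. *)
Definition chain := freemod K (seq G).
HB.instance Definition _ := GRing.Lmodule.on chain.
Implicit Types c : chain.

(** Left multiplication by the basis element [(x, y)] of [KG / R] on the first
    factor [(y, z)] of a bar element. *)
Definition act_seq x y s : chain :=
  if s is y' :: z :: s' then
    if (y' == y) && between x y z then basis (x :: z :: s') else 0
  else 0.
Definition act x y : chain -> chain := flift (act_seq x y).
HB.instance Definition _ x y := GRing.Linear.on (act x y).

Definition prepend_seq x y s : chain :=
  if s is y' :: s' then if y' == y then basis (x :: y :: s') else 0 else 0.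
Definition prepend x y : chain -> chain := flift (prepend_seq x y).
HB.instance Definition _ x y := GRing.Linear.on (prepend x y).

(** The bar differential by recursion: either the first two factors are multiplied,
    or the differential acts behind the first factor. *)
Fixpoint bd_seq s : chain :=
  if s is x :: t then
    if t is y :: _ then - act x y (basis t) - prepend x y (bd_seq t) else 0
  else 0.
Definition bd : chain -> chain := flift bd_seq.
HB.instance Definition _ := GRing.Linear.on bd.

Lemma act_basis x y s : act x y (basis s) = act_seq x y s.
Proof. exact: flift_basis. Qed.
Lemma prepend_basis x y s : prepend x y (basis s) = prepend_seq x y s.
Proof. exact: flift_basis. Qed.
Lemma bd_basis s : bd (basis s) = bd_seq s.
Proof. exact: flift_basis. Qed.

Lemma bd_cons x y s :
  bd (basis (x :: y :: s)) = - act x y (basis (y :: s)) - prepend x y (bd (basis (y :: s))).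
Proof. by rewrite !bd_basis. Qed.

Definition headp x s := ohead s = Some x.

Lemma supp_act x y c : supp (headp x) (act x y c).
Proof.
move: c; apply: freemod_ind; first exact: (lin_closed_comp (act x y) (supp_lin _)).
case=> [|y' [|z s]]; rewrite act_basis /=; try exact: supp0.
by case: ifP => _; [exact: supp_basis|exact: supp0].
Qed.

Lemma supp_prepend x y c : supp (headp x) (prepend x y c).
Proof.
move: c; apply: freemod_ind; first exact: (lin_closed_comp (prepend x y) (supp_lin _)).
case=> [|y' s]; rewrite prepend_basis /=; first exact: supp0.
by case: ifP => _; [exact: supp_basis|exact: supp0].
Qed.

Lemma act_neq x y z c : supp (headp z) c -> z <> y -> act x y c = 0.
Proof.
move=> cz /eqP/negbTE zy; move: c cz; apply: supp_ind.
  exact: (lin_closed_comp (act x y) (@lin_closed0 _ _)).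
by case=> [|y' [|z' s]] // [->]; rewrite act_basis /= ?zy.
Qed.

Lemma prepend_neq x y z c : supp (headp z) c -> z <> y -> prepend x y c = 0.
Proof.
move=> cz /eqP/negbTE zy; move: c cz; apply: supp_ind.
  exact: (lin_closed_comp (prepend x y) (@lin_closed0 _ _)).
by case=> [|y' s] // [->]; rewrite prepend_basis /= zy.
Qed.

Lemma supp_bd x c : supp (headp x) c -> supp (headp x) (bd c).
Proof.
move: c; apply: supp_ind; first exact: (lin_closed_comp bd (supp_lin _)).
case=> [|y [|z s]] // [->]; first by rewrite bd_basis; exact: supp0.
rewrite bd_cons; apply: suppB; last exact: supp_prepend.
by apply: suppN; exact: supp_act.
Qed.

Lemma bd_prepend x y c : bd (prepend x y c) = - act x y c - prepend x y (bd c).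
Proof.
move: c; apply: freemod_ind.
  exact: (lin_closed_eq (bd \o prepend x y) ((\- act x y) \- (prepend x y \o bd))).
case=> [|y' s]; first by rewrite bd_basis prepend_basis act_basis /= !linear0 addr0.
rewrite prepend_basis /=; case: eqP => [->|yy']; first by rewrite bd_cons.
have hb : supp (headp y') (basis (y' :: s) : chain) by exact: supp_basis.
by rewrite (act_neq x hb yy') (prepend_neq x (supp_bd hb) yy') !linear0 addr0.
Qed.

Lemma act_act x y z c :
  act x y (act y z c) = if between x y z then act x z c else 0.
Proof.
case: ifP => xyz; move: c; apply: freemod_ind.
- exact: (lin_closed_eq (act x y \o act y z) (act x z)).
- case=> [|z' [|w s]]; rewrite !act_basis /= ?linear0 //.
  have := between_assoc x y z w; rewrite xyz /=.
  case: eqP => [_ <-|_ _]; last by rewrite linear0.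
  by case: (between y z w); rewrite ?linear0 // act_basis /= eqxx.
- exact: (lin_closed_eq (act x y \o act y z) (\0 : {linear chain -> chain})).
case=> [|z' [|w s]]; rewrite !act_basis /= ?linear0 //.
have := between_assoc x y z w; rewrite xyz /=.
case: eqP => [_|_ _]; last by rewrite linear0.
by case: (between y z w) => /=; rewrite ?linear0 // act_basis /= eqxx => ->.
Qed.

Lemma act_prepend x y z c :
  act x y (prepend y z c) = if between x y z then prepend x z c else 0.
Proof.
case: ifP => xyz; move: c; apply: freemod_ind.
- exact: (lin_closed_eq (act x y \o prepend y z) (prepend x z)).
- case=> [|z' s]; rewrite !prepend_basis /= ?linear0 //.
  by case: eqP => _; rewrite ?linear0 // act_basis /= eqxx xyz.
- exact: (lin_closed_eq (act x y \o prepend y z) (\0 : {linear chain -> chain})).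
case=> [|z' s]; rewrite !prepend_basis /= ?linear0 //.
by case: eqP => _; rewrite ?linear0 // act_basis /= eqxx xyz.
Qed.

Lemma bd_act x y c : bd (act x y c) = act x y (bd c).
Proof.
move: c; apply: freemod_ind; first exact: (lin_closed_eq (bd \o act x y) (act x y \o bd)).
case=> [|y' [|z s]]; rewrite ?act_basis ?bd_basis /= ?linear0 //.
have [->|yy'] := eqVneq y' y; last first.
  rewrite linear0 (@act_neq _ _ y') //; last exact/eqP.
  apply: suppB; last exact: supp_prepend.
  by apply: suppN; exact: supp_act.
rewrite linearB linearN /= act_act act_prepend.
by case: ifP => _; [rewrite bd_basis|rewrite !linear0 addr0].
Qed.

Definition chainp x y m l s : Prop :=
  [/\ headp x s, last x s = y, size s = m.+1, sorted (fun a b => a != b) s & seqlen s = Some l].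

Lemma chainp_cons x y z m l s : chainp x z m.+1 l (x :: y :: s) ->
  exists k l', [/\ dist x y = Some k, x != y, chainp y z m l' (y :: s) & l = (k + l')%N].
Proof.
case=> _ /= lz [sz] /andP[xy ys].
case: (dist x y) => [k|] //=; case E: (foldr _ _ _) => [l'|] //= [<-].
by exists k, l'; split=> //; split; rewrite //= ?sz ?E.
Qed.

(** Multiplying the first factor adds lengths, because [act] vanishes unless the
    distances add up. *)
Lemma act_chainp x y z k m l c : dist x y = Some k -> x != y ->
  supp (chainp y z m l) c -> supp (chainp x z m (k + l)) (act x y c).
Proof.
move=> xyk xy; move: c; apply: supp_ind; first exact: (lin_closed_comp (act x y) (supp_lin _)).
case=> [|y' [|w s]] [] // [->] lz sz st sl; rewrite act_basis /= ?eqxx; first exact: supp0.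
case: ifP => /= xyw; last exact: supp0.
apply: supp_basis; have /andP[yw ws] := st.
have /betweenP[a [b []]] := xyw; rewrite xyk => -[<-] ywb xwkb.
move: sl => /=; rewrite ywb /=; case E: (foldr _ _ _) => [l'|] //= [<-].
split=> //=; last by rewrite xwkb E /= addnA.
apply/andP; split=> //; apply: contra_neq xy => xw; subst w.
by move: xwkb; rewrite distxx => -[] /esym/eqP; rewrite addn_eq0 => /andP[/eqP k0 _];
  apply: dist_eq0; rewrite xyk k0.
Qed.

Lemma prepend_chainp x y z k m l c : dist x y = Some k -> x != y ->
  supp (chainp y z m l) c -> supp (chainp x z m.+1 (k + l)) (prepend x y c).
Proof.
move=> xyk xy; move: c; apply: supp_ind; first exact: (lin_closed_comp (prepend x y) (supp_lin _)).
case=> [|y' s] [] // [->] lz sz st sl; rewrite prepend_basis /= eqxx.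
apply: supp_basis; split=> //=; first by case: sz => ->.
- by rewrite xy.
by move: sl => /=; rewrite xyk; case: (foldr _ _ _) => //= l' [->].
Qed.

Lemma bd_chainp x y m l c : supp (chainp x y m.+1 l) c -> supp (chainp x y m l) (bd c).
Proof.
move: c; apply: supp_ind; first exact: (lin_closed_comp bd (supp_lin _)).
move=> s; elim: s x m l => [|x' s IH] x m l; first by case.
move=> h; have := h; case=> -[xx'] _ _ _ _; subst x'.
case: s IH h => [_ [] //|z s IH /chainp_cons[k [l' [xz nxz zs ->]]]].
rewrite bd_cons; apply: suppB.
  by apply: suppN; exact: act_chainp xz nxz (supp_basis zs).
case: m zs => [|m] zs; last exact: prepend_chainp xz nxz (IH _ _ _ zs).
case: s zs {IH} => [|? ?] [] // _ _ _ _ _.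
by rewrite bd_basis linear0; exact: supp0.
Qed.

End Chains.
Arguments chain : clear implicits.

(** * From chains to paths *)

Section Phi.
Context {K : comPzRingType} {G : digraph}.
Local Notation T := (pathalg K G).
Local Notation J := (Jideal K G).
Local Notation R := (Rideal K G).
Local Notation "R ':^:' n" := (idealX R n) (at level 30).
Local Notation bp p := (basis p : pathalg K G).
Local Notation chain := (chain K G).
Implicit Types (x y z w : G) (p q r v : gpath G) (s t : seq G) (c : chain).

(** The product of the curvatures of consecutive pairs of bar factors, read from the
    right end, so that in odd degree the first factor contributes its geodesic. *)
Fixpoint phi_seq s : T :=
  match s with
  | [::] => 0
  | x :: t =>
    match t with
    | [::] => bp (path0 x)
    | y :: t' =>
      if odd (size t) then geod x y * phi_seq t
      else match t' with [::] => 0 | z :: _ => curv x y z * phi_seq t' end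
    end
  end.
Definition phi : chain -> T := flift phi_seq.
HB.instance Definition _ := GRing.Linear.on phi.

Lemma phi_basis s : phi (basis s) = phi_seq s.
Proof. exact: flift_basis. Qed.

Definition sizep m s := size s = m.+1.

Lemma chainp_size x y m l s : chainp x y m l s -> sizep m s.
Proof. by case. Qed.

Lemma phi_odd x y s : ~~ odd (size s) ->
  phi (basis [:: x, y & s]) = geod x y * phi (basis (y :: s)).
Proof. by move=> os; rewrite !phi_basis /= os. Qed.

Lemma phi_even x y z s : ~~ odd (size s) ->
  phi (basis [:: x, y, z & s]) = curv x y z * phi (basis (z :: s)).
Proof. by move=> /negbTE os; rewrite !phi_basis /= os. Qed.

Lemma geod_target x y : supp (fun p => target p = y) (geod x y : T).
Proof. by apply: supp_sub _ (@geod_supp K G x y) => p []. Qed.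

Lemma geod_source x y : supp (fun p => source p = x) (geod x y : T).
Proof. by apply: supp_sub _ (@geod_supp K G x y) => p []. Qed.

Lemma source_mulr x (u w : T) : supp (fun p => source p = x) u ->
  supp (fun p => source p = x) (u * w : T).
Proof.
move: w; apply: freemod_ind => [|q]; last first.
  move: u; apply: supp_ind => [|p px]; first exact: lin_closed_mulr (supp_lin _).
  have [pq|pq] := pselect (target p = source q); last first.
    by rewrite mul_basis0 //; exact: supp0.
  have [r [-> rx _ _ _]] := @mul_basis_ex K G p q pq.
  by apply: supp_basis; rewrite rx.
split=> [|a w1 w2 h1 h2 ux]; first by move=> _; rewrite mulr0; exact: supp0.
rewrite mulrDr -pathalg_scalerAr; apply: (supp_lin _).2; [exact: h1|exact: h2].
Qed.

Lemma phi_source x s : supp (fun p => source p = x) (phi (basis (x :: s))).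
Proof.
rewrite phi_basis; case: s => [|y s] /=; first exact: supp_basis.
case: odd => /=; last by apply: source_mulr; exact: geod_source.
case: s => [|z s]; first exact: supp0.
apply: source_mulr; apply: suppB.
  by apply: source_mulr; exact: geod_source.
by case: ifP => _; [exact: geod_source|exact: supp0].
Qed.

Lemma phi_prepend_even m x y c : ~~ odd m -> supp (sizep m) c ->
  phi (prepend x y c) = geod x y * phi c.
Proof.
move=> om; move: c; apply: supp_ind.
  exact: (lin_closed_eq (phi \o prepend x y) (bymul (geod x y) \o phi)).
case=> [|y' s] // [sm]; rewrite prepend_basis /=; case: eqP => [->|yy'].
  by rewrite phi_odd // sm.
rewrite linear0 (mul_neq (@geod_target x y) (@phi_source y' s)) //.
exact/nesym.
Qed.

(** Both curvature terms at once: the product of the two geodesics is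
    [geod x y * phi c], and the geodesic of the product comes from [act]. *)
Lemma phi_prepend_odd m x y c : odd m -> supp (sizep m) c ->
  phi (prepend x y c) = geod x y * phi c - phi (act x y c).
Proof.
move=> om; move: c; apply: supp_ind.
  exact: (lin_closed_eq (phi \o prepend x y)
    ((bymul (geod x y) \o phi) \- (phi \o act x y))).
case=> [|y' [|z s]] // [sm]; first by rewrite -sm in om.
have os : ~~ odd (size s) by move: om; rewrite -sm /=.
rewrite prepend_basis act_basis /=; case: eqP => [->|yy'] /=; last first.
  rewrite linear0 (mul_neq (@geod_target x y) (@phi_source y' _)) ?subr0 //.
  exact/nesym.
rewrite phi_even // phi_odd // /curv mulrBl mulrA; congr (_ - _).
by case: ifP => _; rewrite ?linear0 ?mul0r // phi_odd.
Qed.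

Lemma phi_pathp x y m l c : supp (chainp x y m l) c -> supp (pathp x y l) (phi c).
Proof.
move: c; apply: supp_ind; first exact: (lin_closed_comp phi (supp_lin _)).
move=> s; elim/ltn_ind: m s x l => m IH [|x' s] x l; first by case.
move=> h; have [[xx'] ys sm _ sl] := h; subst x'.
case: s h ys sm sl => [|a s] h ys [sm] sl.
  rewrite phi_basis /=; apply: supp_basis; split=> //.
  by case: sl => <-.
case: m sm IH h => // m [sm] IH /chainp_cons[k [l1 [xa nxa as_ ->]]].
have gxa : supp (pathp x a k) (geod x a : T) by have := @geod_supp K G x a; rewrite xa.
have [om|om] := boolP (odd m); last first.
  by rewrite phi_odd ?sm //; apply: supp_mul gxa (IH _ (ltnSn m) _ _ _ as_).
case: s sm as_ ys sl => [|b s] sm as_ ys sl.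
  by case: as_ => _ _ [sm'] _ _; rewrite -sm' in om.
have os : ~~ odd (size s) by case: as_ => _ _ [sm'] _ _; rewrite -sm' in om.
case: m sm IH om as_ => // m [sm] IH om /chainp_cons[k2 [l2 [ab nab bs ->]]].
rewrite phi_even // addnA; apply: supp_mul; last by apply: IH bs.
apply: suppB.
  by apply: supp_mul gxa _; have := @geod_supp K G a b; rewrite ab.
case: ifP => [/betweenP[k' [k2' []]]|_]; last exact: supp0.
rewrite xa ab => -[<-] [<-] xb.
by have := @geod_supp K G x b; rewrite xb.
Qed.

Lemma phi_prepend_prepend n x y z c : supp (sizep n.*2) c ->
  phi (prepend x y (prepend y z c)) = curv x y z * phi c.
Proof.
move: c; apply: supp_ind.
  exact: (lin_closed_eq (phi \o (prepend x y \o prepend y z)) (bymul (curv x y z) \o phi)).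
case=> [|z' t] // [tn]; rewrite prepend_basis /=; case: eqP => [->|zz'].
  by rewrite prepend_basis /= eqxx phi_even // tn odd_double.
have zz := nesym zz'.
rewrite !linear0 /curv mulrBl -mulrA (mul_neq (@geod_target y z) (@phi_source z' t)) //.
rewrite mulr0 sub0r; case: ifP => _; rewrite ?mul0r ?oppr0 //.
by rewrite (mul_neq (@geod_target x z) (@phi_source z' t)) ?oppr0.
Qed.

Lemma phi_R n c : supp (sizep n.*2) c -> phi c \in R :^: n.
Proof.
move: c; apply: supp_ind; first exact: (lin_closed_mem phi (idealX R n)).
elim: n => [//|n IH] [|x [|y [|z s]]] // [sn].
rewrite phi_even; last by rewrite sn odd_double.
by apply: mem_idealM; [exact: curvR|apply: IH; rewrite /sizep /= sn].
Qed.

Lemma phi_JR x y n l c : supp (chainp x y n.*2.+1 l) c -> phi c \in idealM J (R :^: n).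
Proof.
move: c; apply: supp_ind; first exact: (lin_closed_mem phi (idealM J (idealX R n))).
case=> [|a [|b s]]; try by case.
move=> h; have [[ex] _ _ _ _] := h; subst a.
have [k [l' [ab nab [_ _ [sn] _ _] _]]] := chainp_cons h.
rewrite phi_odd ?sn ?odd_double //; apply: mem_idealM; first exact: geodJ.
by apply: phi_R; apply: supp_basis; rewrite /sizep /= sn.
Qed.

(** By the Bianchi identity the faces of the first three factors contribute
    [- geod * curv + curv * geod] times the rest, and induction on the degree turns
    the sum into a telescope.  Its last term ends with the geodesic of the last
    bar factor, hence lies in [R^n J]. *)
Lemma phi_bd_even x e n l c : supp (chainp x e n.*2.+1 l) c ->
  phi (bd c) + phi c \in idealM (R :^: n) J.
Proof.
move: c; apply: supp_ind.
  exact: (lin_closed_mem (phi \o bd \+ phi) (idealM (idealX R n) J)).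
elim: n x l => [|n IH] x l [|x' [|y s]]; try by case.
  move=> h; have [[xx'] _ [] /eqP/nilP -> _ _] := h; subst x'.
  have [k [l' [_ nxy _ _]]] := chainp_cons h.
  rewrite phi_odd // bd_basis /= act_basis /= !linear0 addr0 linear0 add0r.
  by rewrite -[geod _ _ * _]mul1r; apply: mem_idealM => //; apply: idealMr; exact: geodJ.
case: s => [|z [|w s]] h; try by case: h.
have [[xx'] _ _ _ _] := h; subst x'.
have [k [l' [xy nxy ys ll]]] := chainp_cons h.
have [k2 [l2 [yz nyz zs ll2]]] := chainp_cons ys.
have [sn] : size (w :: s) = n.*2.+1.
  by have := chainp_size zs; rewrite /sizep /= => -[->].
have os : ~~ odd (size s) by rewrite sn odd_double.
rewrite (bd_cons x) (bd_cons y).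
pose d : chain := bd (basis [:: z, w & s]).
have dP : supp (sizep n.*2) d.
  by apply: supp_sub _ (bd_chainp (supp_basis zs)) => t; exact: chainp_size.
have f1 : act x y (basis [:: y, z, w & s]) =
    (if between x y z then basis [:: x, z, w & s] else 0 : chain).
  by rewrite act_basis /= eqxx.
have e2 : act y z (basis [:: z, w & s]) =
    (if between y z w then basis [:: y, w & s] else 0 : chain).
  by rewrite act_basis /= eqxx.
have f3 := phi_prepend_prepend x y z dP.
rewrite -/d f1 e2.
have -> : - (if between x y z then basis [:: x, z, w & s] else 0) -
     prepend x y (- (if between y z w then basis [:: y, w & s] else 0) - prepend y z d) =
   (if between y z w then basis [:: x, y, w & s] else 0)
   - (if between x y z then basis [:: x, z, w & s] else 0) + prepend x y (prepend y z d) :> chain.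
  rewrite linearB linearN /= opprB opprK addrA [LHS]addrC addrA; congr (_ - _ + _).
  by case: ifP => _; rewrite ?linear0 // prepend_basis /= eqxx.
rewrite !linearD linearN /= f3.
have -> : phi (basis [:: x, y, z, w & s]) =
   geod x y * curv y z w * phi (basis (w :: s)).
  by rewrite phi_odd /= ?os // phi_even // mulrA.
have fE b a : phi (if b then basis [:: x, a, w & s] else 0 : chain) =
    (if b then curv x a w else 0) * phi (basis (w :: s)).
  by case: b; rewrite ?mul0r ?linear0 ?phi_even.
rewrite !fE -mulrBl -[X in X * _ + _]opprB curv_bianchi.
set U := phi (basis (w :: s)).
have -> : - (geod x y * curv y z w - curv x y z * geod z w) * U + curv x y z * phi d +
    geod x y * curv y z w * U = curv x y z * (phi d + phi (basis [:: z, w & s])).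
  rewrite phi_odd // [RHS]mulrDr opprB mulrBl [LHS]addrAC addrNK [RHS]addrC.
  by congr (_ + _); rewrite mulrA.
rewrite -idealMA; apply: mem_idealM; first exact: curvR.
by apply: (IH z l2).
Qed.
(** Splitting off the first bar factor reduces this to [phi_bd_even]. *)
Lemma phi_bd_odd x y n l c : supp (chainp x y n.*2.+2 l) c ->
  phi (bd c) - phi c \in idealM (idealM J (R :^: n)) J.
Proof.
move: c; apply: supp_ind.
  exact: (lin_closed_mem (phi \o bd \- phi) (idealM (idealM J (idealX R n)) J)).
case=> [|x' [|a s]]; try by case.
move=> h; have [[ex] _ _ _ _] := h; subst x'.
have [k [l' [xa nxa as_ _]]] := chainp_cons h.
have lE : (basis [:: x, a & s] : chain) = prepend x a (basis (a :: s)).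
  by rewrite prepend_basis /= eqxx.
have sz : supp (sizep n.*2.+1) (basis (a :: s) : chain).
  by apply: supp_basis; exact: chainp_size as_.
have bz : supp (sizep n.*2) (bd (basis (a :: s)) : chain).
  by apply: supp_sub _ (bd_chainp (supp_basis as_)) => t; exact: chainp_size.
rewrite lE bd_prepend (@phi_prepend_odd n.*2.+1) //= ?odd_double //.
rewrite linearB linearN /= (@phi_prepend_even n.*2) ?odd_double //.
rewrite opprB addrA [X in X - _]addrAC addNr add0r -opprD -mulrDr.
rewrite -[- _]mulN1r; apply: idealMl; rewrite -idealMA.
by apply: mem_idealM; [exact: geodJ|exact: (phi_bd_even (supp_basis as_))].
Qed.

End Phi.

(** * From paths to chains *)

Section Psi.
Context {K : comPzRingType} {G : digraph}.
Local Notation T := (pathalg K G).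
Local Notation J := (Jideal K G).
Local Notation R := (Rideal K G).
Local Notation "R ':^:' n" := (idealX R n) (at level 30).
Local Notation bp p := (basis p : pathalg K G).
Local Notation chain := (chain K G).
Implicit Types (x y z : G) (p q r v : gpath G) (s t : seq G) (c : chain) (u w : T).

(** The sum over the factorizations of a path into arrows and shortest paths that
    the introduction describes, by recursion on the first arrow.  In positive even
    degree that arrow either is the whole first block or, through [act], extends
    the first block of a factorization of the rest; [act] discards the blocks that
    cease to be shortest. *)
Fixpoint psi_seq m x s : chain :=
  match s with
  | [::] => if m is 0 then basis [:: x] else 0
  | y :: s' =>
    if m is m'.+1 then
      (if odd m then 0 else act x y (psi_seq m y s')) + prepend x y (psi_seq m' y s')
    else 0
  end.
Definition psi m : T -> chain := flift (fun p => psi_seq m (source p) (val p).2).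
HB.instance Definition _ m := GRing.Linear.on (psi m).

Lemma psi_basis m p : psi m (bp p) = psi_seq m (source p) (val p).2.
Proof. exact: flift_basis. Qed.

Lemma psi_chainp m p : supp (chainp (source p) (target p) m (plen p)) (psi m (bp p)).
Proof.
rewrite psi_basis; case: p => -[x s]; rewrite /source /target /plen /=.
elim: s x m => [|y s IH] x m /= xs.
  by case: m => [|m]; [exact: supp_basis|exact: supp0].
case/andP: xs => xy ys; case: m => [|m]; first exact: supp0.
have v1 : path (@arrow G) x [:: y] by rewrite /= xy.
have [] := @dist_arrow _ (exist _ (x, [:: y]) v1 : gpath G) erefl.
rewrite /source /target /= => nxy dxy.
apply: suppD; last exact: prepend_chainp dxy nxy (IH _ _ ys).
case: ifP => _; first exact: supp0.
exact: act_chainp dxy nxy (IH _ _ ys).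
Qed.

Lemma psi_sizep m u : supp (sizep m) (psi m u).
Proof.
move: u; apply: freemod_ind => [|p]; first exact: (lin_closed_comp (psi m) (supp_lin _)).
by apply: supp_sub _ (@psi_chainp m p) => t; exact: chainp_size.
Qed.

Lemma psi_headp m p : supp (headp (source p)) (psi m (bp p)).
Proof. by apply: supp_sub _ (@psi_chainp m p) => t []. Qed.

Lemma psi_pathp x y l m u : supp (pathp x y l) u -> supp (chainp x y m l) (psi m u).
Proof.
move: u; apply: supp_ind => [|p [<- <- <-]]; last exact: psi_chainp.
exact: (lin_closed_comp (psi m) (supp_lin _)).
Qed.

Lemma psi_arrow m v u : plen v = 1%N ->
  psi m.+1 (bp v * u) = (if odd m.+1 then 0 else act (source v) (target v) (psi m.+1 u))
    + prepend (source v) (target v) (psi m u).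
Proof.
move=> v1; move: u; apply: freemod_ind => [|q].
  have [om|om] := boolP (odd m.+1).
    exact: (lin_closed_eq (psi m.+1 \o bymul (bp v))
      (\0 \+ (prepend (source v) (target v) \o psi m))).
  exact: (lin_closed_eq (psi m.+1 \o bymul (bp v))
    ((act (source v) (target v) \o psi m.+1) \+ (prepend (source v) (target v) \o psi m))).
have [vq|vq] := pselect (target v = source q); last first.
  rewrite mul_basis0 // (act_neq _ (@psi_headp m.+1 q)) ?(prepend_neq _ (@psi_headp m q)) ?linear0;
    try exact/nesym.
  by case: ifP; rewrite addr0.
have [r rE rv] := pcatP vq; rewrite (mul_basis rE) !psi_basis rv.
have -> : source r = source v by rewrite /source rv.
case: v v1 vq rE rv => -[x [|y [|? ?]]] //= h _ vq rE rv.
by rewrite -vq.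
Qed.

Lemma psi_arrow_odd n v u : plen v = 1%N ->
  psi n.*2.+1 (bp v * u) = prepend (source v) (target v) (psi n.*2 u).
Proof. by move=> v1; rewrite psi_arrow //= odd_double add0r. Qed.

Lemma psi_arrow_even n v u : plen v = 1%N -> psi n.*2.+2 (bp v * u) =
  act (source v) (target v) (psi n.*2.+2 u) + prepend (source v) (target v) (psi n.*2.+1 u).
Proof. by move=> v1; rewrite psi_arrow //= odd_double. Qed.

Lemma psi0_long p : (0 < plen p)%N -> psi 0 (bp p) = 0.
Proof. by rewrite psi_basis /plen; case: (val p) => x []. Qed.

Lemma psi0_J u : u \in J -> psi 0 u = 0.
Proof.
move: u; apply: J_ind; last exact: psi0_long.
exact: (lin_closed_comp (psi 0) (@lin_closed0 _ _)).
Qed.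

(** The part of [psi (p u)] coming from factorizations whose first cut is at the end
    of [p] or later.  It depends on [p] only through its class modulo [R]
    ([psi_after_parallel], [psi_after_long]), so it cancels when [p] is replaced by
    an element of [R]. *)
Definition psi_after n p u : chain :=
  if shortest p then act (source p) (target p) (psi n.*2.+2 u)
    + prepend (source p) (target p) (psi n.*2.+1 u) else 0.

(** The part of [psi (p u)] coming from factorizations whose first cut lies strictly
    inside [p], for [p] of positive length.  The arrow that follows this cut still
    lies in [p], so the lower-degree [psi] applies to left multiples of [u]. *)
Definition psi_inside n p u : chain := psi n.*2.+2 (bp p * u) - psi_after n p u.

Fact psi_inside_linear n p : linear (psi_inside n p).
Proof.
move=> a u w; rewrite /psi_inside /psi_after; case: (shortest p).
  exact: (linearP ((psi n.*2.+2 \o bymul (bp p)) \- ((act (source p) (target p) \o psi n.*2.+2)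
     \+ (prepend (source p) (target p) \o psi n.*2.+1)))).
exact: (linearP ((psi n.*2.+2 \o bymul (bp p)) \- \0)).
Qed.
HB.instance Definition _ n p :=
  GRing.isLinear.Build K T chain _ (psi_inside n p) (psi_inside_linear n p).

Lemma psi_split n p u : psi n.*2.+2 (bp p * u) = psi_inside n p u + psi_after n p u.
Proof. by rewrite /psi_inside subrK. Qed.

(** A first cut strictly inside a product [p q] is inside [p], at the end of [p], or
    inside [q]. *)
Lemma psi_inside_pcat n p q r u : target p = source q -> pcat p q = Some r ->
  psi_inside n r u = psi_inside n p (bp q * u) + (if shortest p then
    prepend (source p) (target p) (psi n.*2.+1 (bp q * u))
    + act (source p) (target p) (psi_inside n q u)
    else 0).
Proof.
move=> pq rE; have [r' []] := pcat_ex pq; rewrite rE => -[<-] rs rt _.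
have e (V : zmodType) (a b c d : V) : a - (b + c) + (c + (b - d)) = a - d.
  by rewrite opprD !addrA addrNK addrNK.
rewrite /psi_inside /psi_after (shortest_pcat pq rE) -(mul_basis rE) mulrA rs rt -pq.
case: (shortest p); last by rewrite !subr0 addr0.
rewrite linearB /= e; congr (_ - _).
case: (shortest q); rewrite ?linear0 //= linearD /= act_act act_prepend.
by case: ifP => _; rewrite ?addr0.
Qed.

Lemma psi_inside_arrow n v u : plen v = 1%N -> psi_inside n v u = 0.
Proof. by move=> v1; rewrite /psi_inside /psi_after shortest_arrow // psi_arrow_even // subrr. Qed.

Lemma psi_inside_cons n v q p u : plen v = 1%N -> target v = source q -> pcat v q = Some p ->
  psi_inside n p u = prepend (source v) (target v) (psi n.*2.+1 (bp q * u))
    + act (source v) (target v) (psi_inside n q u).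
Proof.
move=> v1 vq E.
by rewrite (psi_inside_pcat _ _ vq E) (psi_inside_arrow n _ v1) add0r shortest_arrow.
Qed.

Lemma psi_inside_rcons n q v p u : plen v = 1%N -> target q = source v -> pcat q v = Some p ->
  psi_inside n p u = psi_inside n q (bp v * u) + (if shortest q then
    prepend (source q) (target q) (psi n.*2.+1 (bp v * u)) else 0).
Proof.
move=> v1 qv E; rewrite (psi_inside_pcat _ _ qv E) (psi_inside_arrow n u v1) linear0.
by case: ifP => _; rewrite ?addr0.
Qed.

Lemma psi_after_parallel n p q u : parallel p q -> psi_after n p u = psi_after n q u.
Proof. by case=> ps qs e1 e2; rewrite /psi_after ps qs e1 e2. Qed.

Lemma psi_after_long n p u : ~~ shortest p -> psi_after n p u = 0.
Proof. by rewrite /psi_after => /negbTE ->. Qed.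

Lemma psi_inside_RJ_aux n : (forall u, u \in idealM (R :^: n) J -> psi n.*2 u = 0) ->
  forall p w, (0 < plen p)%N -> w \in idealM (R :^: n) J -> psi_inside n p w = 0.
Proof.
move=> IH p w.
move: {2}(plen p) (leqnn (plen p)) => k; elim: k p => [|k IHk] p pk p0 wI.
  by rewrite leqNgt p0 in pk.
have [v [q [v1 vq tv pq]]] := path_cons p0.
have [q0|q0] := posnP (plen q); first by rewrite psi_inside_arrow // pq q0.
have [v' [q' [v1' vq' _ _]]] := path_cons q0.
rewrite (psi_inside_cons _ _ v1 tv vq) IHk // ?linear0 ?addr0; last by rewrite -ltnS -pq.
by rewrite -(mul_basis vq') -mulrA psi_arrow_odd // IH ?linear0 // idealMl.
Qed.

(** A product of an element of [R] and of [w] only involves [psi_inside], whose terms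
    end with the value of the lower-degree [psi] at left multiples of [w]. *)
Lemma psi_RJ n u : u \in idealM (R :^: n) J -> psi n.*2 u = 0.
Proof.
elim: n u => [|n IH] u.
  by move=> /idealM_subr; exact: psi0_J.
have inside0 := psi_inside_RJ_aux IH.
rewrite -[u \in _]/(u \in idealM (idealM R (R :^: n)) J) -idealMA doubleS.
move: u; apply: RI_ind.
- exact: (lin_closed_comp (psi n.*2.+2) (@lin_closed0 _ _)).
- move=> p q w pq p0 wI; rewrite linearB /= !psi_split (psi_after_parallel _ _ pq).
  by rewrite !inside0 // ?subrr // -(parallel_plen pq).
by move=> p w pl wI; rewrite psi_split psi_after_long // inside0 ?addr0 // plen_long.
Qed.

Lemma psi_JRJ n u : u \in idealM (idealM J (R :^: n)) J -> psi n.*2.+1 u = 0.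
Proof.
rewrite -idealMA; move: u; apply: JI_ind.
  exact: (lin_closed_comp (psi n.*2.+1) (@lin_closed0 _ _)).
by move=> v w v1 wI; rewrite psi_arrow_odd // psi_RJ // linear0.
Qed.

Lemma psi_inside_RJ n p u : (0 < plen p)%N -> u \in idealM (R :^: n) J -> psi_inside n p u = 0.
Proof. by apply: psi_inside_RJ_aux => w; exact: psi_RJ. Qed.

Lemma act_size0 x y c : supp (sizep 0) c -> act x y c = 0.
Proof.
move: c; apply: supp_ind; first exact: (lin_closed_comp (act x y) (@lin_closed0 _ _)).
by case=> [|a [|]] // _; rewrite act_basis.
Qed.

Lemma bd_size0 c : supp (sizep 0) c -> bd c = 0.
Proof.
move: c; apply: supp_ind; first exact: (lin_closed_comp bd (@lin_closed0 _ _)).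
by case=> [|a [|]] // _; rewrite bd_basis.
Qed.

(** The three statements on [bd] for [psi] in odd degree, for [psi_inside], and for
    [psi] in even degree imply each other in turn as the degree grows; each step is
    isolated as a lemma.  In this one [bd] either multiplies the leading arrow or
    acts behind it, which are the two terms of [psi_arrow_even]. *)
Lemma bd_psi_odd_aux n :
  (if n is k.+1 then forall u, u \in R :^: n -> bd (psi n.*2 u) = psi k.*2.+1 u else True) ->
  forall u, u \in idealM J (R :^: n) -> bd (psi n.*2.+1 u) = - psi n.*2 u.
Proof.
move=> IH; apply: JI_ind.
  exact: (lin_closed_eq (bd \o psi n.*2.+1) (\- psi n.*2)).
move=> v u v1 uI; rewrite psi_arrow_odd // bd_prepend.
case: n IH uI => [_ _|n IH uI].
  rewrite act_size0 ?bd_size0; try exact: psi_sizep.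
  rewrite psi0_J ?linear0 ?addr0 //.
  by apply: idealMr; apply: mem_J; rewrite v1.
by rewrite IH // doubleS psi_arrow_even // opprD.
Qed.

(** By induction on [p] the terms telescope, from the cut after the first arrow to
    the cut at the end of [p]. *)
Lemma bd_psi_inside_aux n :
  (forall u, u \in idealM J (R :^: n) -> bd (psi n.*2.+1 u) = - psi n.*2 u) ->
  forall p u, (0 < plen p)%N -> u \in R :^: n ->
  bd (psi_inside n p u) = psi n.*2.+1 (bp p * u)
    - (if shortest p then prepend (source p) (target p) (psi n.*2 u) else 0).
Proof.
move=> IH p u p0 uI; move: {2}(plen p) (leqnn (plen p)) => k.
elim: k p p0 => [|k IHk] p p0 pk; first by rewrite leqNgt p0 in pk.
have [v [q [v1 vq tv pq]]] := path_cons p0.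
have [q0|q0] := posnP (plen q).
  have p1 : plen p = 1%N by rewrite pq q0.
  by rewrite psi_inside_arrow // linear0 psi_arrow_odd // shortest_arrow // subrr.
have quI : bp q * u \in idealM J (R :^: n) by apply: mem_idealM => //; exact: mem_J.
have qk : (plen q <= k)%N by rewrite -ltnS -pq.
rewrite (psi_inside_cons _ _ v1 tv vq) linearD /= bd_prepend bd_act (IHk q q0 qk) (IH _ quI).
rewrite (shortest_pcat tv vq) (shortest_arrow v1) -(mul_basis vq) -mulrA (psi_arrow_odd _ _ v1).
rewrite linearN opprK linearB /= addrA [X in X + _]addrC addrA addrN add0r.
have [r' []] := pcat_ex tv; rewrite vq => -[<-] -> -> _.
by congr (_ - _); case: (shortest q); rewrite ?linear0 // -tv act_prepend.
Qed.

(** In a combination of paths [p] lying in [R], the contributions of [psi_after] and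
    of the last cut cancel. *)
Lemma bd_psi_even_aux n :
  (forall p u, (0 < plen p)%N -> u \in R :^: n ->
   bd (psi_inside n p u) = psi n.*2.+1 (bp p * u)
    - (if shortest p then prepend (source p) (target p) (psi n.*2 u) else 0)) ->
  forall u, u \in R :^: n.+1 -> bd (psi n.+1.*2 u) = psi n.*2.+1 u.
Proof.
move=> bP; rewrite doubleS; apply: RI_ind.
- exact: (lin_closed_eq (bd \o psi n.*2.+2) (psi n.*2.+1)).
- move=> p q w pq p0 wI; have q0 : (0 < plen q)%N by rewrite -(parallel_plen pq).
  rewrite [psi n.*2.+2 _]linearB ?[psi n.*2.+1 _]linearB /= !psi_split (psi_after_parallel _ _ pq).
  rewrite opprD addrACA subrr addr0 linearB /=.
  rewrite (bP p w p0 wI) (bP q w q0 wI).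
  by case: pq => -> -> -> ->; rewrite opprB addrA addrNK.
move=> p w pl wI; rewrite psi_split psi_after_long // addr0 (bP p w (plen_long pl) wI).
by rewrite (negbTE pl) subr0.
Qed.

Lemma bd_psi_even n u : u \in R :^: n.+1 -> bd (psi n.+1.*2 u) = psi n.*2.+1 u.
Proof.
elim: n u => [|n IH] u.
  have bP := @bd_psi_inside_aux 0 (@bd_psi_odd_aux 0 I).
  exact: bd_psi_even_aux bP _.
have bP := @bd_psi_inside_aux n.+1 (@bd_psi_odd_aux n.+1 IH).
exact: bd_psi_even_aux bP _.
Qed.

Lemma bd_psi_odd n u : u \in idealM J (R :^: n) -> bd (psi n.*2.+1 u) = - psi n.*2 u.
Proof. by apply: bd_psi_odd_aux; case: n => // n w; exact: bd_psi_even. Qed.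

Lemma bd_psi_inside n p u : (0 < plen p)%N -> u \in R :^: n ->
  bd (psi_inside n p u) = psi n.*2.+1 (bp p * u)
    - (if shortest p then prepend (source p) (target p) (psi n.*2 u) else 0).
Proof. by apply: bd_psi_inside_aux => w; exact: bd_psi_odd. Qed.

Lemma phi_psi0 u : phi (psi 0 u) - u \in J.
Proof.
move: u; apply: freemod_ind; first exact: (lin_closed_mem ((phi \o psi 0) \- idfun) J).
move=> p; have [p0|p0] := posnP (plen p).
  rewrite (path0E p0) psi_basis /= phi_basis /= subrr; exact: rpred0.
by rewrite psi0_long // linear0 sub0r -scaleN1r rpredZ // mem_J.
Qed.

(** Each cut between a block [q] and an arrow [v] contributes the curvature
    [geod q * v - geod (q v)], and these telescope from [p] down to the geodesic with
    the same end points.  The induction removes the last arrow of [p], so that [u]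
    varies. *)
Lemma phi_psi_inside_aux n :
  (forall u, u \in R :^: n -> phi (psi n.*2 u) - u \in idealM (R :^: n) J) ->
  forall p u, (0 < plen p)%N -> u \in R :^: n ->
  phi (psi_inside n p u) - (bp p - (if shortest p then geod (source p) (target p) else 0)) * u
    \in idealM (R :^: n.+1) J.
Proof.
move=> IH p u p0 uI; move: {2}(plen p) (leqnn (plen p)) => k.
elim: k p p0 u uI => [|k IHk] p p0 u uI pk; first by rewrite leqNgt p0 in pk.
have [q [v [v1 qv tq pq]]] := path_rcons p0.
have [q0|q0] := posnP (plen q).
  have p1 : plen p = 1%N by rewrite pq q0.
  rewrite (psi_inside_arrow n u p1) linear0 (geod_arrow p1) (shortest_arrow p1) subrr mul0r subr0.
  exact: rpred0.
have qk : (plen q <= k)%N by rewrite -ltnS -pq.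
have vuI : bp v * u \in R :^: n by exact: idealMl.
have IHq := IHk q q0 (bp v * u) vuI qk.
rewrite (psi_inside_rcons _ _ v1 tq qv) linearD /= (shortest_pcat tq qv) (shortest_arrow v1).
have [r' []] := pcat_ex tq; rewrite qv => -[<-] -> -> _; rewrite -(mul_basis qv).
move: IHq; case: (shortest q); last first.
  by rewrite /= !linear0 !addr0 mulrA.
move=> IHq; rewrite psi_arrow_odd // -tq (phi_prepend_prepend _ _ _ (@psi_sizep _ u)).
have dI : curv (source q) (target q) (target v) * (phi (psi n.*2 u) - u)
    \in idealM (R :^: n.+1) J.
  rewrite -[_ \in _]/(_ \in idealM (idealM R (R :^: n)) J) -idealMA.
  by apply: mem_idealM; [exact: curvR|exact: IH].
(* The curvature turns the difference for [q], times [v], into the one for [p]. *)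
set X := (X in X \in _).
have -> : X = (phi (psi_inside n q (bp v * u)) - (bp q - geod (source q) (target q)) * (bp v * u))
    + curv (source q) (target q) (target v) * (phi (psi n.*2 u) - u).
  rewrite /X mulrBr /curv tq (geod_arrow v1) !mulrBl !mulrA /=.
  by rewrite [RHS]addrACA -opprD [_ - _ + (_ - _)]addrA addrNK.
exact: rpredD.
Qed.

Lemma phi_psi_even n u : u \in R :^: n -> phi (psi n.*2 u) - u \in idealM (R :^: n) J.
Proof.
elim: n u => [|n IH] u uI.
  by rewrite -[_ - _]mul1r; apply: mem_idealM => //; exact: phi_psi0.
have pP := phi_psi_inside_aux IH.
move: u uI; apply: RI_ind; rewrite ?doubleS.
- exact: (lin_closed_mem ((phi \o psi n.*2.+2) \- idfun) (idealM (R :^: n.+1) J)).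
- move=> p q w pq p0 wI; have q0 : (0 < plen q)%N by rewrite -(parallel_plen pq).
  rewrite [psi n.*2.+2 _]linearB ?[psi n.*2.+1 _]linearB /= !psi_split (psi_after_parallel _ _ pq).
  rewrite opprD addrACA subrr addr0 linearB /=.
  have e (V : zmodType) (a b c d f : V) : a - b - (c - d) = (a - (c - f)) - (b - (d - f)).
    by rewrite [- (b - _)]opprD [RHS]addrACA -opprD; congr (_ - _); rewrite opprB addrA addrNK.
  have := pP p w p0 wI; have := pP q w q0 wI; case: pq => -> -> -> -> hq hp.
  by rewrite (e _ _ _ _ _ (geod (source q) (target q) * w)) -!mulrBl rpredB.
move=> p w pl wI; have := pP p w (plen_long pl) wI.
by rewrite psi_split psi_after_long // addr0 (negbTE pl) subr0.
Qed.

Lemma phi_psi_odd n u : u \in idealM J (R :^: n) ->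
  phi (psi n.*2.+1 u) - u \in idealM (idealM J (R :^: n)) J.
Proof.
move: u; apply: JI_ind.
  exact: (lin_closed_mem ((phi \o psi n.*2.+1) \- idfun) (idealM (idealM J (R :^: n)) J)).
move=> v w v1 wI; rewrite psi_arrow_odd //.
rewrite (@phi_prepend_even _ _ n.*2) ?odd_double //; last exact: psi_sizep.
rewrite geod_arrow // -mulrBr -idealMA; apply: mem_idealM; last exact: phi_psi_even.
by apply: mem_J; rewrite v1.
Qed.

End Psi.

(** * The homotopy between [psi \o phi] and the identity *)

Section Homotopy.
Context {K : comPzRingType} {G : digraph}.
Local Notation T := (pathalg K G).
Local Notation J := (Jideal K G).
Local Notation R := (Rideal K G).
Local Notation "R ':^:' n" := (idealX R n) (at level 30).
Local Notation bp p := (basis p : pathalg K G).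
Local Notation chain := (chain K G).
Implicit Types (x y z : G) (p q r v : gpath G) (s t : seq G) (c : chain) (u w : T).

(** [psi_inside] along the geodesic from [x] to [y], written so that it is linear in
    [u] and defined for every pair ([psi_inside_geodE]). *)
Definition psi_inside_geod n x y u : chain := psi n.*2.+2 (geod x y * u)
  - (act x y (psi n.*2.+2 u) + prepend x y (psi n.*2.+1 u)).

Fact psi_inside_geod_linear n x y : linear (psi_inside_geod n x y).
Proof.
exact: (linearP ((psi n.*2.+2 \o bymul (geod x y)) \- ((act x y \o psi n.*2.+2)
     \+ (prepend x y \o psi n.*2.+1)))).
Qed.
HB.instance Definition _ n x y :=
  GRing.isLinear.Build K T chain _ (psi_inside_geod n x y) (psi_inside_geod_linear n x y).

Lemma psi_inside_geodE n x y p u : geod x y = bp p -> source p = x -> target p = y -> shortest p ->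
  psi_inside_geod n x y u = psi_inside n p u.
Proof. by rewrite /psi_inside_geod /psi_inside /psi_after => -> -> -> ->. Qed.

(** The homotopy anticommutes with prepending a bar factor, up to a correction in
    odd degree.  The correction is forced by degree one, where [psi (phi a)] keeps
    [a] only if it is an arrow: [bd] applied to the cuts inside [geod a] gives the
    difference. *)
Fixpoint htpy_seq s : chain :=
  if s is x :: t then
    if t is y :: _ then
      - prepend x y (htpy_seq t)
      - (if odd (size t) then psi_inside_geod (size t)./2 x y (phi (basis t)) else 0)
    else 0
  else 0.
Definition htpy : chain -> chain := flift htpy_seq.
HB.instance Definition _ := GRing.Linear.on htpy.

Lemma htpy_basis s : htpy (basis s) = htpy_seq s.
Proof. exact: flift_basis. Qed.

Lemma htpy_cons x y t : htpy (basis [:: x, y & t]) = - prepend x y (htpy (basis (y :: t)))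
  - (if odd (size t) then 0 else psi_inside_geod (size t)./2 x y (phi (basis (y :: t)))).
Proof.
rewrite !htpy_basis /= uphalf_half; case: (boolP (odd (size t))) => //= _.
Qed.

Lemma htpy_prepend m x y c : supp (fun s => headp y s /\ sizep m s) c ->
  htpy (prepend x y c) = - prepend x y (htpy c)
  - (if odd m then 0 else psi_inside_geod m./2 x y (phi c)).
Proof.
move: c; apply: supp_ind.
  have [om|om] := boolP (odd m).
    exact: (lin_closed_eq (htpy \o prepend x y) ((\- (prepend x y \o htpy)) \- \0)).
  exact: (lin_closed_eq (htpy \o prepend x y)
    ((\- (prepend x y \o htpy)) \- (psi_inside_geod m./2 x y \o phi))).
by case=> [|y' s] [] // [->] [sm]; rewrite prepend_basis /= eqxx htpy_cons sm.
Qed.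

Lemma psi_inside_geod_bd n x y k u : dist x y = Some k -> x != y -> u \in R :^: n ->
  bd (psi_inside_geod n x y u) = psi n.*2.+1 (geod x y * u) - prepend x y (psi n.*2 u).
Proof.
move=> xyk xy uI; have [p [pE px py pk ps]] := @geodP K _ _ _ _ xyk.
have p0 : (0 < plen p)%N by rewrite pk (dist_gt0 xy xyk).
rewrite (psi_inside_geodE _ _ pE px py ps) pE (bd_psi_inside p0 uI).
by rewrite ps px py.
Qed.

Lemma psi_inside_geod_RJ n x y k u : dist x y = Some k -> x != y -> u \in idealM (R :^: n) J ->
  psi_inside_geod n x y u = 0.
Proof.
move=> xyk xy uI; have [p [pE px py pk ps]] := @geodP K _ _ _ _ xyk.
by rewrite (psi_inside_geodE _ _ pE px py ps) psi_inside_RJ // pk (dist_gt0 xy xyk).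
Qed.

(** The case of [psi_inside_pcat] where both paths are geodesics: the product of
    geodesics is a geodesic up to curvature. *)
Lemma psi_inside_geod_comp n x y z k l u : dist x y = Some k -> dist y z = Some l ->
  psi_inside_geod n x y (geod y z * u) + prepend x y (psi n.*2.+1 (geod y z * u))
    + act x y (psi_inside_geod n y z u)
  = psi n.*2.+2 (curv x y z * u) + (if between x y z then psi_inside_geod n x z u else 0).
Proof.
move=> xyk yzl; have [p [pE px py pk ps]] := @geodP K _ _ _ _ xyk.
have [q [qE qy qz ql qs]] := @geodP K _ _ _ _ yzl.
have pq : target p = source q by rewrite py qy.
have [r [rE rx rz _]] := pcat_ex pq.
rewrite (psi_inside_geodE _ _ pE px py ps) (psi_inside_geodE _ _ qE qy qz qs) qE.
have := psi_inside_pcat n u pq rE; rewrite ps px py [X in _ = X]addrA => <-.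
rewrite /psi_inside /psi_after (shortest_pcat pq rE) ps qs /= rx rz px py qz -(mul_basis rE).
rewrite /curv pE qE mulrBl linearB /=; case: ifP => _; last by rewrite mul0r !linear0 !addr0.
by rewrite /psi_inside_geod addrA addrNK.
Qed.

Lemma htpy_act n x y z s : size s = n.*2.+1 ->
  act x y (htpy (basis [:: y, z & s])) = htpy (act x y (basis [:: y, z & s])).
Proof.
move=> sn; rewrite act_basis /= eqxx /= htpy_cons sn /= odd_double /= subr0 linearN /= act_prepend.
by case: ifP => _; rewrite ?linear0 // htpy_cons sn /= odd_double /= subr0.
Qed.

(** The final bookkeeping of [homotopy] in even degree. *)
Lemma abelian_rearrange (V : zmodType) (a a' b c g l l' p e f : V) :
  a - a' = e - f -> b + c = l - l' -> g + l' + f = p + e ->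
  - (- a - b) - 0 + (- a' - (- c - - g)) = l - p.
Proof.
move=> h1 h2 h3; have -> : p = g + l' + f - e by rewrite h3 addrK.
rewrite !opprD !opprK oppr0 addr0.
rewrite [LHS](AC (2*(1*2)) ((1*3)*(2*4)*5)) /= h1 h2.
by rewrite [LHS](AC (2*2*1) (3*(5*4*2*1))).
Qed.

(** Induction on the chain [c] left by the first bar factor [(x, y)].  By the rule
    for [htpy] and [prepend], what remains is the commutator of [htpy] and [act x y],
    the correction at [c] or at [bd c], and the commutator of [psi \o phi] and
    [prepend x y].  In odd degree the first vanishes, and the last is the boundary
    of the correction at [c].  In even degree the correction occurs at [bd c], where
    [phi (bd c)] is [- phi c] up to terms that it kills, and the three cancel by
    [psi_inside_geod_comp]. *)
Lemma homotopy x z m l s : chainp x z m l s ->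
  bd (htpy (basis s)) + htpy (bd (basis s)) = basis s - psi m (phi (basis s)).
Proof.
elim: s x m l => [|x' [|y t] IH] x m l h; first by case: h.
  have [_ _ [<-] _ _] := h.
  by rewrite htpy_basis bd_basis /= !linear0 phi_basis psi_basis /= subrr addr0.
have [[xx'] _ [sm] _ _] := h; subst x' m.
have [k [l' [xyk xy yt ll]]] := chainp_cons h.
have {}IH := IH _ _ _ yt.
have lE : (basis [:: x, y & t] : chain) = prepend x y (basis (y :: t)).
  by rewrite prepend_basis /= eqxx.
pose c : chain := basis (y :: t).
have cP : supp (fun s => headp y s /\ sizep (size t) s) c by apply: supp_basis.
move: IH; rewrite lE -/c bd_prepend linearB linearN /= => IH.
have cm : supp (chainp y z (size t) l') c by exact: supp_basis.
rewrite (htpy_prepend x cP).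
rewrite linearB linearN /= bd_prepend.
(* The degree of the chain is [(size t).+1]. *)
have [om|em] := boolP (odd (size t)); last first.
  have [n tn] : exists n, size t = n.*2 by exists (size t)./2; rewrite even_halfK.
  rewrite tn doubleK in cm IH *.
  have cs : supp (sizep n.*2) c by apply: supp_sub _ cm => s; exact: chainp_size.
  have hA : htpy (prepend x y (bd c)) = - prepend x y (htpy (bd c)).
    case: n tn cm cs {IH} => [|n] tn cm cs; first by rewrite bd_size0 // !linear0.
    have dP : supp (fun s => headp y s /\ sizep n.*2.+1 s) (bd c).
      by apply: supp_sub _ (bd_chainp cm) => s [].
    by rewrite (htpy_prepend x dP) /= odd_double subr0.
  have hB : act x y (htpy c) = htpy (act x y c).
    case: t tn @c {h lE yt cP cm cs hA IH em} => [|w t] tn c.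
      by rewrite htpy_basis act_basis /= !linear0.
    by apply: (@htpy_act n.-1); case: n tn => [|n] //= [->].
  have uI : phi c \in R :^: n by exact: phi_R.
  rewrite hA hB (psi_inside_geod_bd xyk xy uI) (phi_prepend_even x y _ cs) ?odd_double //.
  have := congr1 (prepend x y) IH; rewrite linearB linearD /= => e.
  rewrite !opprD !opprK -[prepend x y c](subrK (prepend x y (psi n.*2 (phi c)))) -e.
  by rewrite [LHS](AC (2*2*2) ((1*5)*((2*6)*4*3))) /= addrN add0r.
have [n tn] : exists n, size t = n.*2.+1.
  by exists (size t)./2; rewrite -[LHS]odd_double_half om.
rewrite tn in cm IH *.
have dP : supp (fun s => headp y s /\ sizep n.*2 s) (bd c).
  by apply: supp_sub _ (bd_chainp cm) => s [].
have cs : supp (sizep n.*2.+1) c by apply: supp_sub _ cm => s; exact: chainp_size.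
rewrite (htpy_prepend x dP) odd_double doubleK.
have -> : psi_inside_geod n x y (phi (bd c)) = - psi_inside_geod n x y (phi c).
  apply/eqP; rewrite -addr_eq0 -linearD /=; apply/eqP.
  exact: psi_inside_geod_RJ xyk xy (phi_bd_even cm).
case: t tn @c h lE yt cP cm cs {om dP} IH => // w t [tn] c h lE yt cP cm cs IH.
have [k' [l2 [yw nyw wt ll2]]] := chainp_cons yt.
pose u : T := phi (basis (w :: t) : chain).
have pc : phi c = geod y w * u by rewrite phi_odd // tn odd_double.
have pl : phi (prepend x y c) = curv x y w * u by rewrite -lE phi_even // tn odd_double.
have hc : act x y (htpy c) - htpy (act x y c) =
    (if between x y w then psi_inside_geod n x w u else 0) - act x y (psi_inside_geod n y w u).
  rewrite htpy_cons tn odd_double doubleK linearB linearN /= act_prepend act_basis /= eqxx /=.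
  case: ifP => _; last by rewrite !linear0 !add0r addr0.
  by rewrite htpy_cons tn odd_double doubleK opprB opprK [LHS](AC (2*2) (1*4*(3*2))) /= addNr add0r.
have := congr1 (prepend x y) IH; rewrite linearB linearD /= => e.
have := psi_inside_geod_comp n u xyk yw; rewrite -pc -pl => e2.
rewrite linear0; apply: abelian_rearrange hc e e2.
Qed.

End Homotopy.

(** * Maps of subquotients and of direct sums *)

Section Subquotients.
Context {K : pzRingType}.

Lemma cls_sum (V : lmodType K) (A B : submodClosed V) (I : Type) (r : seq I) (F : I -> V) :
  (forall i, F i \in A) -> cls A B (\sum_(i <- r) F i) = \sum_(i <- r) cls A B (F i).
Proof.
move=> FA; elim: r => [|i r IH]; last first.
  by rewrite !big_cons -IH -[F i]scale1r cls_lin ?scale1r // rpred_sum.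
rewrite !big_nil; have := @cls_lin K V A B (-1) 0 0 (rpred0 A) (rpred0 A).
by rewrite scaler0 addr0 scaleN1r addNr.
Qed.

Lemma cls0 (V : lmodType K) (A B : submodClosed V) : cls A B 0 = 0.
Proof. by have := @cls_sum V A B void [::] (fun i => match i with end) (fun i => match i with end);
  rewrite !big_nil. Qed.

Lemma cls_eq0 (V : lmodType K) (A B : submodClosed V) u : u \in A ->
  (cls A B u == 0) = (u \in B).
Proof. by move=> uA; rewrite -(cls0 A B) cls_eq ?rpred0 // subr0. Qed.

Section Map.
Variables (V W : lmodType K) (A B : submodClosed V) (A' B' : submodClosed W).
Variables (g : {linear V -> W}).
Hypotheses (gA : forall v, v \in A -> g v \in A')
  (gB : forall v, v \in A -> v \in B -> g v \in B').

Definition subquot_map (q : subquot A B) : subquot A' B' := cls A' B' (g (val (repr q))).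

Lemma subquot_map_cls v : v \in A -> subquot_map (cls A B v) = cls A' B' (g v).
Proof.
move=> vA; have rA : val (repr (cls A B v)) \in A by exact: valP.
apply/eqP; rewrite cls_eq ?gA // -linearB; apply: gB; first by rewrite -scaleN1r rpredD ?rpredZ.
by have := cls_eq B rA vA; rewrite {1}/cls valKd reprK eqxx => <-.
Qed.

Fact subquot_map_linear : linear subquot_map.
Proof.
move=> a p q; have [u uA ->] := cls_surj p; have [v vA ->] := cls_surj q.
rewrite -cls_lin // !subquot_map_cls // ?linearP ?cls_lin ?gA //.
by rewrite rpredD ?rpredZ.
Qed.
Definition subquot_lin : {linear subquot A B -> subquot A' B'} :=
  HB.pack subquot_map (GRing.isLinear.Build _ _ _ _ subquot_map subquot_map_linear).
End Map.

Section Lift.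
Variables (M : nat -> lmodType K) (N : lmodType K) (f : forall l, {linear M l -> N}).

Definition dsum_lift (u : dsum M) : N := \sum_(l \in [set: nat]) f l (u l).

Lemma dsum_liftE (A : {fset nat}) (u : dsum M) :
  (forall l, l \notin A -> u l = 0) -> dsum_lift u = \sum_(l <- A) f l (u l).
Proof. by move=> uA; apply: fsbigTE => l /uA ->; rewrite linear0. Qed.

Lemma dsum_supp (u : dsum M) : exists A : {fset nat}, forall l, l \notin A -> u l = 0.
Proof.
exists (fset_set [set l | u l <> 0]) => l; rewrite in_fset_set; last exact: dsum_finite.
by apply: contraNeq => /eqP ul; rewrite inE.
Qed.

Fact dsum_lift_linear : linear dsum_lift.
Proof.
move=> a u v; have [A uA] := dsum_supp u; have [B vB] := dsum_supp v.
have uAB l : l \notin (A `|` B)%fset -> u l = 0 by rewrite inE negb_or => /andP[/uA].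
have vAB l : l \notin (A `|` B)%fset -> v l = 0 by rewrite inE negb_or => /andP[_ /vB].
rewrite (dsum_liftE uAB) (dsum_liftE vAB) (@dsum_liftE (A `|` B)%fset); last first.
  by move=> l lAB; rewrite dsumDE dsumZE uAB // vAB // scaler0 addr0.
rewrite scaler_sumr -big_split; apply: eq_bigr => l _.
by rewrite dsumDE dsumZE linearP.
Qed.
HB.instance Definition _ := GRing.isLinear.Build K (dsum M) N _ dsum_lift dsum_lift_linear.
End Lift.

End Subquotients.

(** * Lists of vertices and the graded pieces of the magnitude complex *)

Section Transfer.
Context {K : comPzRingType} {G : digraph}.
Local Notation T := (pathalg K G).
Local Notation chain := (chain K G).
Implicit Types (x y z : G) (s : seq G) (c : chain).

Definition mtuple_of n l s : option (mtuple G n l) :=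
  obind insub (insub s : option (n.+1.-tuple G)).

Definition chain_of_MC n l : MC K G n l -> chain :=
  flift (fun t : mtuple G n l => basis (tval (val t))).
HB.instance Definition _ n l := GRing.Linear.on (@chain_of_MC n l).

Definition MC_of_chain n l : chain -> MC K G n l :=
  flift (fun s => oapp basis 0 (mtuple_of n l s)).
HB.instance Definition _ n l := GRing.Linear.on (@MC_of_chain n l).

Lemma chain_of_MC_basis n l (t : mtuple G n l) : chain_of_MC (basis t) = basis (tval (val t)).
Proof. exact: flift_basis. Qed.
Lemma MC_of_chain_basis n l s : MC_of_chain n l (basis s) = oapp basis 0 (mtuple_of n l s).
Proof. exact: flift_basis. Qed.

Lemma mtuple_ofK n l (t : mtuple G n l) : mtuple_of n l (tval (val t)) = Some t.
Proof. by rewrite /mtuple_of valK /= valK. Qed.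

Lemma mtuple_of_some n l s (t : mtuple G n l) : mtuple_of n l s = Some t -> tval (val t) = s.
Proof.
rewrite /mtuple_of; case: insubP => //= t' _ <-; case: insubP => //= t'' _ h [<-].
by rewrite -h.
Qed.

Lemma mtuple_chainp n l (t : mtuple G n l) :
  chainp (thead (val t)) (last (thead (val t)) (val t)) n l (tval (val t)).
Proof.
case: t => t /= /andP[ts /eqP tl]; split=> //; last exact: size_tuple.
by case/tupleP: t {ts tl} => x t; rewrite /headp theadE.
Qed.

Lemma chainp_mtuple x y n l s : chainp x y n l s ->
  exists t : mtuple G n l, tval (val t) = s.
Proof.
case=> _ _ /eqP sn ss sl.
have tP : sorted (fun x y => x != y) (Tuple sn) && (seqlen (Tuple sn) == Some l).
  by rewrite ss sl eqxx.
by exists (exist _ (Tuple sn) tP).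
Qed.

Lemma chain_of_MCK n l (c : MC K G n l) : MC_of_chain n l (chain_of_MC c) = c.
Proof.
move: c; apply: freemod_ind.
  exact: (lin_closed_eq (@MC_of_chain n l \o @chain_of_MC n l) idfun).
by move=> t; rewrite chain_of_MC_basis MC_of_chain_basis mtuple_ofK.
Qed.

Lemma MC_of_chainK x y n l c : supp (chainp x y n l) c -> chain_of_MC (MC_of_chain n l c) = c.
Proof.
move: c; apply: supp_ind; first exact: (lin_closed_eq (@chain_of_MC n l \o @MC_of_chain n l) idfun).
by move=> s /chainp_mtuple[t <-]; rewrite MC_of_chain_basis mtuple_ofK chain_of_MC_basis.
Qed.

Lemma MC_of_chain_neq x y n l k c : supp (chainp x y n l) c -> k <> l -> MC_of_chain n k c = 0.
Proof.
move=> + kl; move: c; apply: supp_ind.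
  exact: (lin_closed_comp (@MC_of_chain n k) (@lin_closed0 _ _)).
move=> s [_ _ _ _ sl]; rewrite MC_of_chain_basis; case E: (mtuple_of n k s) => [t|] //.
have := mtuple_chainp t; rewrite (mtuple_of_some E) => -[_ _ _ _].
by rewrite sl => -[lk]; case: kl.
Qed.

Lemma chain_of_MC_inj n l : injective (@chain_of_MC n l).
Proof. exact: can_inj (@chain_of_MCK n l). Qed.

Definition rmnth (i : nat) s := take i s ++ drop i.+1 s.

Lemma tval_del n (i : 'I_n.+2) (t : n.+2.-tuple G) : tval (del i t) = rmnth i t.
Proof.
have [x0 _] : exists x0 : G, True by exists (thead t).
apply: (@eq_from_nth _ x0).
  rewrite size_tuple /rmnth size_cat size_drop size_tuple size_takel ?size_tuple; last exact: ltnW.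
  by have := ltn_ord i; lia.
move=> j; rewrite size_tuple => jn; rewrite -[j]/(nat_of_ord (Ordinal jn)) -tnth_nth tnth_mktuple.
rewrite (tnth_nth x0) /rmnth nth_cat size_takel ?size_tuple; last exact: ltnW.
rewrite /= /bump; case: (ltnP j i) => ij; first by rewrite nth_take.
by rewrite nth_drop; congr (nth x0 t _); lia.
Qed.

Definition face_seq l i s : chain :=
  if sorted (fun a b => a != b) (rmnth i s) && (seqlen (rmnth i s) == Some l)
  then basis (rmnth i s) else 0.

Lemma chain_of_MC_face n l (i : 'I_n.+2) (t : mtuple G n.+1 l) :
  chain_of_MC (face K i t) = face_seq l i (tval (val t)).
Proof.
rewrite /face /face_seq -tval_del; case: insubP => [t' t'P tE|/negbTE] /=.
  by rewrite chain_of_MC_basis tE t'P.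
by move=> ->; rewrite linear0.
Qed.

Lemma face_seq0 x y n l s : chainp x y n.+1 l s -> face_seq l 0 s = 0.
Proof.
case: s => [|x' [|a t]] h; try by case: h.
have [[xx'] _ _ _ _] := h; subst x'.
have [k [l' [xa nxa [_ _ _ _ at_] ->]]] := chainp_cons h.
rewrite /face_seq /rmnth take0 drop1 [behead _]/= at_; case: ifP => // /andP[_ /eqP[e]].
by have := dist_gt0 nxa xa; lia.
Qed.

Lemma face_seq1 x a z m l t : chainp x z m.+1 l [:: x, a & t] ->
  face_seq l 1 [:: x, a & t] = act x a (basis (a :: t)).
Proof.
move=> h; have [k [l' [xa nxa ht ->]]] := chainp_cons h; have k0 := dist_gt0 nxa xa.
rewrite /face_seq /rmnth /= drop0 act_basis; case: t ht {h} => [|b t] ht /=.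
  by case: eqP => // -[e]; lia.
have [_ _ _ /= /andP[_ bt]] := ht; rewrite bt andbT eqxx /=.
case ab: (dist a b) => [d|] //=; case E: (foldr _ _ _) => [f|] //= [<-].
have -> : between x a b = (dist x b == Some (k + d)%N).
  by rewrite /between xa ab /=; case: (dist x b) => [e|] //=; rewrite eq_sym.
have [xb|_] := eqVneq x b; first by rewrite xb distxx /=; case: eqP => // -[]; lia.
case: (dist x b) => [e|] //=; congr (if _ then _ else _).
by apply/eqP/eqP => -[?]; congr Some; lia.
Qed.

Lemma face_seqSS x a k l i t : dist x a = Some k -> x != a ->
  face_seq (k + l)%N i.+2 [:: x, a & t] = prepend x a (face_seq l i.+1 (a :: t)).
Proof.
move=> xa nxa; rewrite /face_seq /rmnth /= nxa xa /=.
case: (foldr _ _ _) => [f|] /=; last by rewrite !andbF linear0.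
rewrite ![Some _ == Some _]/(_ == _) !/(_ == _) /= eqn_add2l.
by case: ifP => _; rewrite ?linear0 // prepend_basis /= eqxx.
Qed.

(** The face that deletes the first vertex shortens the tuple, the next one is [act],
    and the others act behind the first bar factor. *)
Lemma bd_faces x y n l s : chainp x y n.+1 l s ->
  bd (basis s : chain) = \sum_(i < n.+2) (-1) ^+ i *: face_seq l i s.
Proof.
elim: n x l s => [|n IH] x l [|x' [|a s]] h; try by case: h.
all: have [[xx'] _ [sz] _ _] := h; subst x'.
all: have [k [l' [xa nxa as_ ll]]] := chainp_cons h.
all: rewrite bd_cons big_ord_recl (face_seq0 h) scaler0 add0r big_ord_recl /= (face_seq1 h).
all: rewrite expr1 scaleN1r.
  case: s sz {h as_} => // _; rewrite big_ord0 addr0 [X in prepend _ _ X]bd_basis linear0.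
  by rewrite subr0.
congr (_ + _); rewrite (IH _ _ _ as_) big_ord_recl (face_seq0 as_) scaler0 add0r -linearN -sumrN.
rewrite linear_sum; apply: eq_bigr => i _; rewrite /= ll face_seqSS // /bump !add1n.
by rewrite -scaleNr -mulN1r -exprS linearZ.
Qed.

Lemma chain_of_MC_bdry n l (c : MC K G n.+1 l) : chain_of_MC (bdry c) = bd (chain_of_MC c).
Proof.
move: c; apply: freemod_ind.
  exact: (lin_closed_eq (@chain_of_MC n l \o @bdry K G n l) (bd \o @chain_of_MC n.+1 l)).
move=> t; rewrite /bdry flift_basis chain_of_MC_basis (bd_faces (mtuple_chainp t)) linear_sum.
by apply: eq_bigr => i _; rewrite linearZ /= chain_of_MC_face.
Qed.

Definition degp n s := exists x y l, chainp x y n l s.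

Lemma MC_of_chain_bd n l c : supp (degp n.+1) c ->
  MC_of_chain n l (bd c) = bdry (MC_of_chain n.+1 l c).
Proof.
move: c; apply: supp_ind.
  exact: (lin_closed_eq (@MC_of_chain n l \o bd) (@bdry K G n l \o @MC_of_chain n.+1 l)).
move=> s [x [y [k h]]]; have [lk|/eqP lk] := eqVneq l k.
  subst k; have [t ts] := chainp_mtuple h.
  by rewrite -ts -(chain_of_MC_basis t) -chain_of_MC_bdry !chain_of_MCK.
have hb := @supp_basis K _ _ _ h.
by rewrite (MC_of_chain_neq hb lk) (MC_of_chain_neq (bd_chainp hb) lk) linear0.
Qed.

(** The set of lengths is only bounded from below so that the statement is stable
    under linear combinations. *)
Lemma MC_of_chain_decomp n c : supp (degp n) c -> exists A : {fset nat}, forall A' : {fset nat},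
  (A `<=` A')%fset -> (forall l, l \notin A' -> MC_of_chain n l c = 0) /\
  c = \sum_(l <- A') chain_of_MC (MC_of_chain n l c).
Proof.
move: c; apply: supp_ind.
  split=> [|a u v [A hA] [B hB]].
    by exists fset0 => A' _; split=> [l _|]; rewrite ?linear0 // big1 // => l _; rewrite !linear0.
  exists (A `|` B)%fset => A' /[!fsubUset]/andP[/hA[u0 uE] /hB[v0 vE]].
  split=> [l lA|]; first by rewrite linearP /= u0 // v0 // scaler0 addr0.
  rewrite {1}uE {1}vE scaler_sumr -big_split; apply: eq_bigr => l _.
  by rewrite !linearP /=.
move=> s [x [y [k h]]]; have hb := @supp_basis K _ _ _ h.
exists [fset k]%fset => A' /[!fsub1set] kA; split=> [l lA|].
  by apply: (MC_of_chain_neq hb) => lk; rewrite lk kA in lA.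
rewrite (big_fsetD1 k kA) /= (MC_of_chainK hb) big1_fset ?addr0 // => l.
rewrite !inE => /andP[/eqP lk _] _.
by rewrite (MC_of_chain_neq hb lk) linear0.
Qed.

Lemma cyclesP n l (c : MC K G n l) : c \in cycles K G n l <-> bd (chain_of_MC c) = 0.
Proof.
case: n c => [|n] c; last first.
  rewrite -chain_of_MC_bdry; split=> [/eqP ->|e]; first exact: linear0.
  by apply/eqP; apply: chain_of_MC_inj; rewrite e linear0.
split=> // _; apply: bd_size0; move: c; apply: freemod_ind.
  exact: (lin_closed_comp (@chain_of_MC 0 l) (supp_lin _)).
by move=> t; rewrite chain_of_MC_basis; apply: supp_basis; exact: size_tuple.
Qed.

End Transfer.

(** * Cycles and boundaries in terms of R and J *)

Section BarModel.
Context {K : comPzRingType} {G : digraph}.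
Local Notation T := (pathalg K G).
Local Notation J := (Jideal K G).
Local Notation R := (Rideal K G).
Local Notation "R ':^:' n" := (idealX R n) (at level 30).
Local Notation chain := (chain K G).
Implicit Types (x y : G) (s : seq G) (c : chain) (z u : T).

(** What the comparison maps must satisfy in degree [m] for [phi] to induce an
    isomorphism from the homology onto [num / den], with inverse induced by [psi];
    the homotopy is the same for all degrees. *)
Record bar_model m (num den : {pred T}) : Prop := BarModel {
  phi_cycle : forall c, supp (degp m) c -> bd c = 0 -> phi c \in num;
  phi_bdry : forall c, supp (degp m.+1) c -> phi (bd c) \in den;
  psi_cycle : forall z, z \in num -> bd (psi m z) = 0;
  phi_psi : forall z, z \in num -> phi (psi m z) - z \in den;
  psi_bdry : forall z, z \in den -> exists u, psi m z = bd (psi m.+1 u)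
}.

Lemma degp_size m s : degp m s -> sizep m s.
Proof. by move=> [x [y [l]]] /chainp_size. Qed.

Lemma degp_bd_even n c : supp (degp n.*2.+1) c ->
  phi (bd c) + phi c \in idealM (R :^: n) J.
Proof.
move: c; apply: supp_ind.
  exact: (lin_closed_mem (phi \o bd \+ phi) (idealM (idealX R n) J)).
by move=> s [x [y [l /supp_basis h]]]; exact: phi_bd_even (h K).
Qed.

Lemma degp_bd_odd n c : supp (degp n.*2.+2) c ->
  phi (bd c) - phi c \in idealM (idealM J (R :^: n)) J.
Proof.
move: c; apply: supp_ind.
  exact: (lin_closed_mem (phi \o bd \- phi) (idealM (idealM J (idealX R n)) J)).
by move=> s [x [y [l /supp_basis h]]]; exact: phi_bd_odd (h K).
Qed.

Lemma degp_JR n c : supp (degp n.*2.+1) c -> phi c \in idealM J (R :^: n).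
Proof.
move: c; apply: supp_ind; first exact: (lin_closed_mem phi (idealM J (idealX R n))).
by move=> s [x [y [l /supp_basis h]]]; exact: phi_JR (h K).
Qed.

Lemma degp_R n c : supp (degp n.*2) c -> phi c \in R :^: n.
Proof. by move=> h; apply: phi_R; apply: supp_sub _ h => s; exact: degp_size. Qed.

Lemma mem_addm (A B : submodClosed T) u z : u \in A -> z \in B -> u + z \in addm A B.
Proof. by move=> uA zB; apply/asboolP; exists u, z. Qed.

Lemma even_model n : bar_model n.*2 (even_num K G n) (even_den K G n).
Proof.
split.
- case: n => [//|n] c cP bc; apply/andP; split; first exact: degp_R.
  by have := degp_bd_odd cP; rewrite bc linear0 sub0r -scaleN1r => /(rpredZ (-1));
    rewrite scalerA mulN1r opprK scale1r.
- move=> c cP; have nJ : - phi c \in idealM J (R :^: n).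
    by rewrite -scaleN1r rpredZ // degp_JR.
  by have := mem_addm nJ (degp_bd_even cP); rewrite addrC addrK.
- case: n => [|n] z; first by move=> _; apply: bd_size0; exact: psi_sizep.
  by case/andP => zR zJ; rewrite bd_psi_even // psi_JRJ.
- move=> z zN; rewrite -[_ - _]add0r; apply: mem_addm; first exact: rpred0.
  by apply: phi_psi_even; case: n zN => // n /andP[].
move=> _ /asboolP[a [b [aJ bJ ->]]]; exists (- a).
by rewrite linearD /= (psi_RJ bJ) addr0 !linearN /= bd_psi_odd // opprK.
Qed.

Lemma odd_model n : bar_model n.*2.+1 (odd_num K G n) (odd_den K G n).
Proof.
split.
- move=> c cP bc; apply/andP; split; first exact: degp_JR.
  by have := degp_bd_even cP; rewrite bc linear0 add0r.
- move=> c cP; have := mem_addm (@degp_R n.+1 c cP) (degp_bd_odd cP).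
  by rewrite addrC addrNK.
- by move=> z /andP[zR zJ]; rewrite bd_psi_odd // psi_RJ // oppr0.
- move=> z /andP[zJ _]; rewrite -[_ - _]add0r; apply: mem_addm; first exact: rpred0.
  exact: phi_psi_odd.
move=> _ /asboolP[a [b [aJ bJ ->]]]; exists a.
by rewrite linearD /= (psi_JRJ bJ) addr0 bd_psi_even.
Qed.

Lemma htpy_chainp x y m l c : supp (chainp x y m l) c -> supp (chainp x y m.+1 l) (htpy c).
Proof.
move: c; apply: supp_ind; first exact: (lin_closed_comp htpy (supp_lin _)).
move=> s; elim: s x m l => [|x' [|a s] IH] x m l h; try by case: h.
  by rewrite htpy_basis; exact: supp0.
have [[xx'] _ [sm] _ _] := h; subst x' m.
have [k [l' [xa nxa as_ ->]]] := chainp_cons h.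
rewrite htpy_cons; apply: suppB.
  by apply: suppN; apply: prepend_chainp xa nxa (IH _ _ _ as_).
have [os|os] := boolP (odd (size s)); first exact: supp0.
have pP := phi_pathp (@supp_basis K _ _ _ as_).
have -> : (size s).+2 = (size s)./2.*2.+2 by rewrite even_halfK.
have gP : supp (pathp x a k) (geod x a : T) by have := @geod_supp K G x a; rewrite xa.
apply: suppB; first by apply: psi_pathp; exact: supp_mul gP pP.
apply: suppD; first exact: act_chainp xa nxa (psi_pathp pP).
exact: prepend_chainp xa nxa (psi_pathp pP).
Qed.

Lemma homotopy_degp m c : supp (degp m) c -> bd (htpy c) + htpy (bd c) = c - psi m (phi c).
Proof.
move: c; apply: supp_ind.
  exact: (lin_closed_eq ((bd \o htpy) \+ (htpy \o bd)) (idfun \- (psi m \o phi))).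
by move=> s [x [y [l h]]]; exact: homotopy h.
Qed.

End BarModel.

Section BarModelLemmas.
Context {K : comPzRingType} {G : digraph}.
Local Notation T := (pathalg K G).
Local Notation chain := (chain K G).
Implicit Types (x y : G) (s : seq G) (c : chain) (z u : T).

Lemma MC_of_chain_cycles n l c : supp (degp n) c -> bd c = 0 ->
  MC_of_chain n l c \in cycles K G n l.
Proof.
case: n => // n cg bc; have e : bdry (MC_of_chain n.+1 l c) = 0.
  by rewrite -MC_of_chain_bd // bc linear0.
exact/eqP.
Qed.

Lemma MC_of_chain_chain_of_MC_neq n l k (c : MC K G n k) : l <> k ->
  MC_of_chain n l (chain_of_MC c) = 0.
Proof.
move=> lk; move: c; apply: freemod_ind.
  exact: (lin_closed_comp (@MC_of_chain K G n l \o @chain_of_MC K G n k) (@lin_closed0 _ _)).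
by move=> t; rewrite chain_of_MC_basis; apply: MC_of_chain_neq (supp_basis (mtuple_chainp t)) lk.
Qed.

Lemma MC_of_chain_psi_neq n l k z : supp (fun p => plen p = l) z -> k <> l ->
  MC_of_chain n k (psi n z) = 0.
Proof.
move=> + kl; move: z; apply: supp_ind.
  exact: (lin_closed_comp (@MC_of_chain K G n k \o psi n) (@lin_closed0 _ _)).
by move=> p pl; apply: MC_of_chain_neq (@psi_chainp K G n p) _; rewrite pl.
Qed.

Lemma psi_degp n z : supp (degp n) (psi n z).
Proof.
move: z; apply: freemod_ind; first exact: (lin_closed_comp (psi n) (supp_lin _)).
move=> p; apply: supp_sub _ (@psi_chainp K G n p) => s h.
by exists (source p), (target p), (plen p).
Qed.

Lemma htpy_degp n c : supp (degp n) c -> supp (degp n.+1) (htpy c).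
Proof.
move: c; apply: supp_ind; first exact: (lin_closed_comp htpy (supp_lin _)).
move=> s [x [y [l /supp_basis h]]].
by apply: supp_sub _ (htpy_chainp (h K)) => t h'; exists x, y, l.
Qed.

End BarModelLemmas.

(** * The isomorphism, with prescribed end points *)

Section MainIso.
Variables (K : comPzRingType) (G : digraph) (m : nat).
Local Notation T := (pathalg K G).
Local Notation chain := (chain K G).
Implicit Types (x y : G) (s : seq G) (c : chain) (z u : T).

Variables (num den : {pred T}) (model : bar_model m num den).
Variable D : rel G.
Variable C : forall l k, submodClosed (MC K G k l).
Hypothesis C_D : forall l k (c : MC K G k l), c \in C l k <->
  supp (fun t => D (thead (val t)) (last (thead (val t)) (val t))) c.
Variables (B B' : submodClosed T).
Hypothesis B_D : forall z,
  z \in B <-> z \in num /\ supp (fun p => D (source p) (target p)) z.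
Hypothesis B'_D : forall z,
  z \in B' <-> z \in den /\ supp (fun p => D (source p) (target p)) z.

Definition degDp k s := exists x y l, D x y /\ chainp x y k l s.
Definition degDlp k l s := exists x y, D x y /\ chainp x y k l s.

Lemma degDp_degp k s : degDp k s -> degp k s.
Proof. by move=> [x [y [l [_ h]]]]; exists x, y, l. Qed.

Lemma degDlp_degDp k l s : degDlp k l s -> degDp k s.
Proof. by move=> [x [y h]]; exists x, y, l. Qed.

Lemma chain_of_MC_degDlp k l (c : MC K G k l) : c \in C l k -> supp (degDlp k l) (chain_of_MC c).
Proof.
move=> /C_D; move: c; apply: supp_ind.
  exact: (lin_closed_comp (@chain_of_MC _ _ k l) (supp_lin _)).
move=> t Dt; rewrite chain_of_MC_basis; apply: supp_basis; do 2!eexists; split; first exact: Dt.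
exact: mtuple_chainp.
Qed.

Lemma MC_of_chain_degDp k l c : supp (degDp k) c -> MC_of_chain k l c \in C l k.
Proof.
move=> cD; apply/C_D; move: c cD; apply: supp_ind.
  exact: (lin_closed_comp (@MC_of_chain _ _ k l) (supp_lin _)).
move=> s [x [y [l' [Dxy h]]]]; rewrite MC_of_chain_basis.
case E: (mtuple_of k l s) => [t|] /=; last exact: supp0.
apply: supp_basis; have := mtuple_of_some E; move: h => /[swap] <-.
have := mtuple_chainp t; case=> e _ _ _ _ [e' yE _ _ _].
have [xE] : Some x = Some (thead (val t)) by rewrite -e -e'.
by move: Dxy; rewrite -yE xE.
Qed.

Lemma phi_degDlp k l c : supp (degDlp k l) c ->
  supp (fun p => D (source p) (target p) /\ plen p = l) (phi c).
Proof.
move: c; apply: supp_ind; first exact: (lin_closed_comp phi (supp_lin _)).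
move=> s [x [y [Dxy /supp_basis h]]].
by apply: supp_sub _ (phi_pathp (h K)) => p [-> -> ->].
Qed.

Lemma phi_degDp k c : supp (degDp k) c -> supp (fun p => D (source p) (target p)) (phi c).
Proof.
move: c; apply: supp_ind; first exact: (lin_closed_comp phi (supp_lin _)).
move=> s [x [y [l [Dxy /supp_basis h]]]].
by apply: supp_sub _ (phi_pathp (h K)) => p [-> -> _].
Qed.

Lemma psi_degDp k z : supp (fun p => D (source p) (target p)) z -> supp (degDp k) (psi k z).
Proof.
move: z; apply: supp_ind; first exact: (lin_closed_comp (psi k) (supp_lin _)).
move=> p Dp; apply: supp_sub _ (@psi_chainp K G k p) => s h.
by exists (source p), (target p), (plen p).
Qed.

(** The projection of chains onto those with end points in [D].  It is used to cut
    down a chain that bounds a cycle of [D]. *)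
Definition projD : chain -> chain :=
  flift (fun s => if s is x :: t then if D x (last x t) then basis s else 0 else 0).
HB.instance Definition _ := GRing.Linear.on projD.

Lemma projD_chainp x y k l c : supp (chainp x y k l) c -> projD c = if D x y then c else 0.
Proof.
move: c; apply: supp_ind.
  case: (D x y); first exact: (lin_closed_eq projD idfun).
  exact: (lin_closed_eq projD (\0 : {linear chain -> chain})).
by case=> [|x' s] [] // [->] /= <- _ _ _; rewrite /projD flift_basis.
Qed.

Lemma projD_id k c : supp (degDp k) c -> projD c = c.
Proof.
move: c; apply: supp_ind; first exact: (lin_closed_eq projD idfun).
by move=> s [x [y [l [Dxy h]]]]; rewrite (projD_chainp (supp_basis h)) Dxy.
Qed.

Lemma projD_bd k c : supp (degp k.+1) c -> projD (bd c) = bd (projD c).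
Proof.
move: c; apply: supp_ind; first exact: (lin_closed_eq (projD \o bd) (bd \o projD)).
move=> s [x [y [l h]]]; have hb := @supp_basis K _ _ _ h.
rewrite (projD_chainp hb) (projD_chainp (bd_chainp hb)).
by case: (D x y); rewrite ?linear0.
Qed.

Lemma projD_degDp k c : supp (degp k) c -> supp (degDp k) (projD c).
Proof.
move: c; apply: supp_ind; first exact: (lin_closed_comp projD (supp_lin _)).
move=> s [x [y [l h]]]; have hb := @supp_basis K _ _ _ h.
rewrite (projD_chainp hb); case: ifP => Dxy; last exact: supp0.
by apply: supp_basis; exists x, y, l.
Qed.

Lemma degDlp_degp k l c : supp (degDlp k l) c -> supp (degp k) c.
Proof. by apply: supp_sub => s /degDlp_degDp /degDp_degp. Qed.

Fact magmap_cycle l (c : MC K G m l) :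
  c \in capm (cycles K G m l) (C l m) -> phi (chain_of_MC c) \in B.
Proof.
case/andP => /cyclesP bc /chain_of_MC_degDlp cD; apply/B_D; split.
  exact: (phi_cycle model (degDlp_degp cD)).
by apply: supp_sub _ (phi_degDlp cD) => p [].
Qed.

Fact magmap_bdry l (c : MC K G m l) :
  c \in capm (cycles K G m l) (C l m) -> c \in imagem (@bdry K G m l) (C l m.+1) ->
  phi (chain_of_MC c) \in B'.
Proof.
case/andP => _ /chain_of_MC_degDlp cD cb; apply/B'_D; split; last first.
  by apply: supp_sub _ (phi_degDlp cD) => p [].
case/asboolP: cb => e /chain_of_MC_degDlp eD ->; rewrite chain_of_MC_bdry.
exact: (phi_bdry model (degDlp_degp eD)).
Qed.

Let N := subquot B B'.
Let M l : lmodType K := homology (C l) m.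

Definition magmap_comp l : {linear M l -> N} :=
  @subquot_lin K _ _ _ _ B B' (phi \o @chain_of_MC K G m l) (@magmap_cycle l) (@magmap_bdry l).

Lemma magmap_comp_cls l (c : MC K G m l) : c \in capm (cycles K G m l) (C l m) ->
  magmap_comp l (cls _ _ c) = cls B B' (phi (chain_of_MC c)).
Proof.
exact: (@subquot_map_cls K _ _ _ _ B B' (phi \o @chain_of_MC K G m l)
  (@magmap_cycle l) (@magmap_bdry l)).
Qed.

Definition magmap : {linear dsum_graded M -> subquot_graded B B'} := dsum_lift magmap_comp.

Lemma magmap_clsE (A : {fset nat}) (u : dsum M) (c : forall l, MC K G m l) :
  (forall l, l \notin A -> u l = 0) ->
  (forall l, c l \in capm (cycles K G m l) (C l m)) ->
  (forall l, u l = cls _ _ (c l)) ->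
  magmap u = cls B B' (phi (\sum_(l <- A) chain_of_MC (c l))).
Proof.
move=> uA cC uE; rewrite [LHS](dsum_liftE _ uA) linear_sum cls_sum; last first.
  by move=> l; apply: magmap_cycle.
by apply: eq_bigr => l _; rewrite uE; apply: magmap_comp_cls.
Qed.

Lemma psi_num z : z \in B -> forall l,
  MC_of_chain m l (psi m z) \in capm (cycles K G m l) (C l m).
Proof.
move=> /B_D[zN /(psi_degDp (k := m)) pD] l; apply/andP; split; last exact: MC_of_chain_degDp.
apply: MC_of_chain_cycles; last exact: (psi_cycle model zN).
by apply: supp_sub _ pD => s; exact: degDp_degp.
Qed.

(** The components of [psi m z] in the various lengths are cycles because [bd]
    preserves the length, and [phi] maps their sum to [z] modulo the denominator. *)
Lemma magmap_onto z : z \in B -> exists u : dsum M, magmap u = cls B B' z /\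
  forall l, u l = cls _ _ (MC_of_chain m l (psi m z)).
Proof.
move=> zB; have /B_D[zN zD] := zB.
have pD := psi_degDp (k := m) zD.
have pg : supp (degp m) (psi m z) by apply: supp_sub _ pD => s; exact: degDp_degp.
have [A hA] := MC_of_chain_decomp pg; have [cA cE] := hA A (fsubset_refl A).
pose u0 l : M l := cls _ _ (MC_of_chain m l (psi m z)).
have u0A l : l \notin A -> u0 l = 0 by move=> lA; rewrite /u0 cA // cls0.
have fin : finite_set [set l | u0 l <> 0].
  apply: sub_finite_set (finite_fset A) => l /= h.
  by apply: contrapT => lA; apply: h; apply: u0A; apply/negP.
exists (DSum fin); split=> //.
rewrite (magmap_clsE (A := A) (c := fun l => MC_of_chain m l (psi m z))) //; last exact: psi_num.
have pB : phi (psi m z) \in B.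
  apply/B_D; split; last exact: phi_degDp pD.
  exact: (phi_cycle model pg (psi_cycle model zN)).
rewrite -cE; apply/eqP; rewrite cls_eq //; apply/B'_D; split.
  exact: (phi_psi model zN).
exact: suppB (phi_degDp pD) zD.
Qed.

(** If [phi e] lies in the denominator then [psi (phi e)] is a boundary, hence so is
    the cycle [e] by the homotopy. *)
Lemma magmap_inj : injective magmap.
Proof.
apply: raddf_inj => u; have [A uA] := dsum_supp u => mu0.
pose c l : MC K G m l := val (repr (u l)).
have cC l : c l \in capm (cycles K G m l) (C l m) by exact: valP.
have uE l : u l = cls _ _ (c l) by rewrite /cls valKd reprK.
pose e := \sum_(l <- A) chain_of_MC (c l).
have eD : supp (degDp m) e.
  apply: lin_closed_sum => [|l]; first exact: supp_lin.
  by have /andP[_ /chain_of_MC_degDlp] := cC l; apply: supp_sub => s; exact: degDlp_degDp.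
have eg : supp (degp m) e by apply: supp_sub _ eD => s; exact: degDp_degp.
have be : bd e = 0.
  rewrite linear_sum big1 // => l _.
  by have /andP[/cyclesP] := cC l.
have eB : phi e \in B.
  by apply/B_D; split; [exact: (phi_cycle model eg be)|exact: phi_degDp eD].
have := magmap_clsE uA cC uE; rewrite mu0 => /esym/eqP; rewrite cls_eq0 //.
move=> /B'_D[phiD _]; have [w wE] := psi_bdry model phiD.
pose f := htpy e + psi m.+1 w.
have fg : supp (degp m.+1) f.
  by apply: suppD; [exact: htpy_degp|exact: psi_degp].
have ef : e = bd (projD f).
  rewrite -(projD_bd fg) linearD /= -wE.
  have := homotopy_degp eg; rewrite be linear0 addr0 => ->.
  by rewrite subrK (projD_id eD).
apply: dsumP => l; have [lA|/uA //] := boolP (l \in A).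
rewrite uE; apply/eqP; rewrite cls_eq0; last exact: cC.
apply/asboolP.
exists (MC_of_chain m.+1 l (projD f)); first by apply: MC_of_chain_degDp; exact: projD_degDp fg.
have pg : supp (degp m.+1) (projD f).
  by apply: supp_sub _ (projD_degDp fg) => s; exact: degDp_degp.
apply: etrans (MC_of_chain_bd l pg).
rewrite -ef linear_sum (big_fsetD1 l lA) /= chain_of_MCK big1_fset ?addr0 // => k.
by rewrite !inE => /andP[/eqP kl _] _; rewrite MC_of_chain_chain_of_MC_neq //; apply/nesym.
Qed.

Lemma magmap_graded_iso : graded_iso magmap.
Proof.
split.
  have onto (q : subquot B B') : exists u : dsum M, magmap u = q.
    by have [z zB ->] := cls_surj q; have [u [uE _]] := magmap_onto zB; exists u.
  exists (fun q => projT1 (cid (onto q))) => [u|q]; last by case: cid.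
  by apply: magmap_inj; case: cid.
move=> l; apply/seteqP; split=> [_ [u /= u0 <-]|_ [z [zB zl] <-]].
  pose c k : MC K G m k := val (repr (u k)).
  have cC k : c k \in capm (cycles K G m k) (C k m) by exact: valP.
  have uE k : u k = cls _ _ (c k) by rewrite /cls valKd reprK.
  have uA k : k \notin [fset l]%fset -> u k = 0 by rewrite inE => /eqP /u0.
  exists (phi (chain_of_MC (c l))); last by rewrite (magmap_clsE uA cC uE) big_seq_fset1.
  split; first exact: magmap_cycle.
  have /andP[_ /chain_of_MC_degDlp/phi_degDlp h] := cC l.
  by apply/mem_span_basis; apply: supp_sub _ h => p [].
have [u [uE uk]] := magmap_onto zB; exists u => // k kl.
rewrite uk (MC_of_chain_psi_neq _ (mem_deg zl)) // cls0 //.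
Qed.

End MainIso.

(** * The whole complex and its pieces *)

Section Compatible.
Variables (K : comPzRingType) (G : digraph) (m : nat).
Local Notation T := (pathalg K G).
Implicit Types (x y : G) (z : T).
Variables (num den : pathIdeal K G) (model : bar_model m num den).

(** The end points singled out by a corner.  With the constant relation instead,
    the same construction handles the whole complex. *)
Definition inxy (xy : G * G) : rel G := fun a b => (a == xy.1) && (b == xy.2).

Lemma MCfull_D l k (c : MC K G k l) : c \in MCfull K G l k <->
  supp (fun t => (fun _ _ : G => true) (thead (val t)) (last (thead (val t)) (val t))) c.
Proof. by split. Qed.

Lemma MCxy_D (xy : G * G) l k (c : MC K G k l) : c \in MCxy K xy.1 xy.2 l k <->
  supp (fun t => inxy xy (thead (val t)) (last (thead (val t)) (val t))) c.
Proof.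
rewrite mem_span_basis; split; apply: supp_sub => t.
  by move=> [tx ty]; rewrite /inxy tx ty !eqxx.
by case/andP => /eqP tx /eqP ty; split=> //; rewrite -tx.
Qed.

Lemma full_D (I : pathIdeal K G) z : z \in I <->
  z \in I /\ supp (fun p => (fun _ _ : G => true) (source p) (target p)) z.
Proof. by split=> [|[]]. Qed.

Lemma idealxy_D (xy : G * G) (I : pathIdeal K G) z : z \in idealxy xy.1 xy.2 I <->
  z \in I /\ supp (fun p => inxy xy (source p) (target p)) z.
Proof.
rewrite mem_idealxy; split=> -[zI]; move=> h; split=> //; move: h; apply: supp_sub => p.
  by move=> [-> ->]; rewrite /inxy !eqxx.
by case/andP => /eqP -> /eqP ->.
Qed.

Definition fullmap : {linear MHgr K G m -> iquot num den} :=
  magmap model MCfull_D (full_D num) (full_D den).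

Definition xymap xy : {linear MHxygr K m xy -> iquotxy num den xy} :=
  magmap model (@MCxy_D xy) (@idealxy_D xy num) (@idealxy_D xy den).

Lemma xymap_incl xy u :
  fullmap (@MHxy_incl K G m xy u) = @iquotxy_incl K G num den xy (xymap xy u).
Proof.
have [A uA] := dsum_supp u.
pose c l : MC K G m l := val (repr (u l)).
have cC l : c l \in capm (cycles K G m l) (MCxy K xy.1 xy.2 l m) by exact: valP.
have uE l : u l = cls _ _ (c l) by rewrite /cls valKd reprK.
have wE : phi (\sum_(l <- A) chain_of_MC (c l)) \in idealxy xy.1 xy.2 num.
  rewrite linear_sum; apply: rpred_sum => l _.
  exact: (magmap_cycle model (@MCxy_D xy) (@idealxy_D xy num) (cC l)).
rewrite /xymap (magmap_clsE _ _ _ _ uA cC uE) /iquotxy_incl subquot_incl_cls //.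
apply: (magmap_clsE model MCfull_D (full_D num) (full_D den)) => l.
- by move=> /uA /= ->; rewrite linear0.
- by have /andP[cl _] := cC l; apply/andP.
by rewrite [LHS]/= uE; apply: subquot_incl_cls; exact: cC.
Qed.

Lemma magnitude_iso :
  exists phi : {linear MHgr K G m -> iquot num den},
    graded_iso phi /\
    exists phi_ : forall xy : G * G, {linear MHxygr K m xy -> iquotxy num den xy},
      (forall xy : G * G, graded_iso (phi_ xy)) /\
      compatible (@MHxy_incl K G m) (@iquotxy_incl K G num den) phi phi_.
Proof.
exists fullmap; split; first exact: magmap_graded_iso.
exists xymap; split=> [xy|u]; first exact: magmap_graded_iso.
by rewrite linear_sum; apply: eq_bigr => xy _; apply: xymap_incl.
Qed.

End Compatible.

Theorem theorem3p5 (K : comPzRingType) (G : digraph) (n : nat) :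
  (exists phi : {linear MHgr K G n.*2 -> iquot (even_num K G n) (even_den K G n)},
    graded_iso phi /\
    exists phi_ : forall xy : G * G,
        {linear MHxygr K n.*2 xy -> iquotxy (even_num K G n) (even_den K G n) xy},
      (forall xy : G * G, graded_iso (phi_ xy)) /\
      compatible (@MHxy_incl K G n.*2)
        (@iquotxy_incl K G (even_num K G n) (even_den K G n)) phi phi_) /\
  (exists psi : {linear MHgr K G n.*2.+1 -> iquot (odd_num K G n) (odd_den K G n)},
    graded_iso psi /\
    exists psi_ : forall xy : G * G,
        {linear MHxygr K n.*2.+1 xy -> iquotxy (odd_num K G n) (odd_den K G n) xy},
      (forall xy : G * G, graded_iso (psi_ xy)) /\
      compatible (@MHxy_incl K G n.*2.+1)
        (@iquotxy_incl K G (odd_num K G n) (odd_den K G n)) psi psi_).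
Proof. by split; apply: magnitude_iso; [exact: even_model|exact: odd_model]. Qed.
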